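(* Fix $k\ge 2$ and $p\ge 1$. With probability going to $1$ exponentially fast as $n\to+\infty$, the subgroup $H\subset\mathbb{F}_k$ generated by $p$ elements $w_1,\dots,w_p$ chosen uniformly at random, independently, in the ball of radius $n$ of $\mathbb{F}_k$ is $\mathrm{Aut}$-malnormal (and therefore $\mathrm{Aut}(\mathbb{F}_k,H)=\mathrm{Inn}_H(\mathbb{F}_k)$).
   Context: $\mathbb{F}_k$ is the free group of rank $k$ with a fixed free basis $X$; the ball of radius $n$ is the set of elements represented by reduced words in $X^{\pm1}$ of length at most $n$. For a subgroup $H$ of a group $G$: $\mathrm{Aut}(G,H)$ is the group of automorphisms of $G$ leaving $H$ invariant; $\mathrm{Inn}_H(G)$ is the group of conjugations $g\mapsto hgh^{-1}$ of $G$ with $h\in H$; $H$ is $\mathrm{Aut}$-malnormal if any $\alpha\in\mathrm{Aut}(G)$ such that $\alpha(H)\cap H\ne\{1\}$ belongs to $\mathrm{Inn}_H(G)$. An event (depending on $n$) occurs with probability going to $1$ exponentially fast as $n\to+\infty$ if the probability that it does not occur is bounded by $C\kappa^{-n}$ for some constants $C>0$ and $\kappa>1$. *)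

(* Defs.v *)
From HB Require Import structures.
From mathcomp Require Import all_boot all_order all_algebra.
From mathcomp Require Import all_classical reals.

Set Implicit Arguments.
Unset Strict Implicit.
Unset Printing Implicit Defensive.

Import Order.TTheory GRing.Theory Num.Theory.

Local Open Scope classical_set_scope.

(* The free group of rank k is modelled by reduced words in the letters of its
   fixed basis and their inverses: (i, true) stands for the basis element x_i
   and (i, false) for x_i^-1. *)

Notation letter k := ('I_k * bool)%type.

Section Words.
Variable k : nat.
Implicit Types (a b : letter k) (s t u w : seq (letter k)).

Definition linv a : letter k := (a.1, ~~ a.2).

Definition reduced : pred (seq (letter k)) :=
  sorted (fun a b => b != linv a).

(* Left multiplication of a reduced word by one letter. *)
Definition push a w : seq (letter k) :=
  if w is b :: w' then (if b == linv a then w' else a :: w) else [:: a].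

Definition reduce s : seq (letter k) := foldr push [::] s.

Lemma linvK : involutive linv.
Proof. by case=> i b; rewrite /linv /= negbK. Qed.

Lemma reduced_push a w : reduced w -> reduced (push a w).
Proof.
case: w => //= b w Hw; case: ifPn => [_|nab]; first exact: path_sorted Hw.
by rewrite /= nab.
Qed.

Lemma reduced_foldr_push s w : reduced w -> reduced (foldr push w s).
Proof. by move=> Hw; elim: s => //= a s; exact: reduced_push. Qed.

Lemma reduced_reduce s : reduced (reduce s).
Proof. exact: reduced_foldr_push. Qed.

Lemma reduce_id w : reduced w -> reduce w = w.
Proof.
elim: w => //= a w IHw Hw; have /IHw E := path_sorted Hw.
rewrite -/(reduce w) E; case: w Hw {IHw E} => //= b w /andP[/negbTE -> _].
by [].
Qed.

Lemma push_linvK a w : reduced w -> push a (push (linv a) w) = w.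
Proof.
case: w => [|b w] /=; first by rewrite eqxx.
rewrite linvK; case: eqVneq => [->|nab _] /=; last by rewrite eqxx.
by case: w => //= c w /andP[/negbTE -> _].
Qed.

Lemma foldr_push_push a u w :
  reduced w -> foldr push w (push a u) = push a (foldr push w u).
Proof.
move=> Hw; case: u => //= b u; case: eqVneq => // ->.
by rewrite push_linvK //; exact: reduced_foldr_push.
Qed.

Lemma foldr_push_reduce s w :
  reduced w -> foldr push w (reduce s) = foldr push w s.
Proof. by move=> Hw; elim: s => //= a s IHs; rewrite foldr_push_push // IHs. Qed.

Lemma reduce_catl s t : reduce (reduce s ++ t) = reduce (s ++ t).
Proof.
by rewrite /reduce !foldr_cat foldr_push_reduce //; exact: reduced_reduce.
Qed.

Lemma reduce_catr s t : reduce (s ++ reduce t) = reduce (s ++ t).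
Proof.
rewrite /reduce !foldr_cat; congr foldr.
by apply: reduce_id; exact: reduced_reduce.
Qed.

Definition winv s : seq (letter k) := rev (map linv s).

Lemma reduced_winv w : reduced w -> reduced (winv w).
Proof.
rewrite /reduced /winv rev_sorted sorted_map.
apply: sub_sorted => a b /=; apply: contra => /eqP E.
by rewrite E linvK.
Qed.

Lemma winvK : involutive winv.
Proof.
move=> s; rewrite /winv map_rev revK -map_comp -[RHS]map_id.
by apply: eq_map => a /=; rewrite linvK.
Qed.

Lemma reduce_mulV s : reduce (s ++ winv s) = [::].
Proof.
elim: s => //= a s IHs.
rewrite /winv /= rev_cons -cats1 catA -/(reduce _) -reduce_catl.
by rewrite -/(winv s) IHs /= eqxx.
Qed.

Lemma reduce_Vmul s : reduce (winv s ++ s) = [::].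
Proof. by rewrite -{2}[s]winvK reduce_mulV. Qed.

End Words.

Record free_group (k : nat) := FreeGroup {
  fg_word :> seq (letter k);
  _ : reduced fg_word
}.

HB.instance Definition _ k := [isSub for @fg_word k].
HB.instance Definition _ k := [Choice of free_group k by <:].

Section FreeGroup.
Variable k : nat.
Implicit Types u v w : free_group k.

Definition fg_one : free_group k := @FreeGroup k [::] isT.
Definition fg_inv u : free_group k := FreeGroup (reduced_winv (valP u)).
Definition fg_mul u v : free_group k :=
  FreeGroup (reduced_reduce (fg_word u ++ fg_word v)).

Lemma fg_mulA : associative fg_mul.
Proof.
by move=> u v w; apply: val_inj; rewrite /= reduce_catl reduce_catr catA.
Qed.

Lemma fg_mul1 : left_id fg_one fg_mul.
Proof. by move=> u; apply: val_inj; rewrite /= reduce_id //; case: u. Qed.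

Lemma fg_mulr1 : right_id fg_one fg_mul.
Proof. by move=> u; apply: val_inj; rewrite /= cats0 reduce_id //; case: u. Qed.

Lemma fg_mulV : left_inverse fg_one fg_inv fg_mul.
Proof. by move=> u; apply: val_inj; rewrite /= reduce_Vmul. Qed.

Lemma fg_mulrV : right_inverse fg_one fg_inv fg_mul.
Proof. by move=> u; apply: val_inj; rewrite /= reduce_mulV. Qed.

HB.instance Definition _ :=
  isGroup.Build (free_group k) fg_mulA fg_mul1 fg_mulr1 fg_mulV fg_mulrV.

End FreeGroup.

(* The ball of radius n as a finite type, together with its inclusion into the
   free group. *)
Record wball (k n : nat) := WBall {
  wball_word :> n.-bseq (letter k);
  _ : reduced wball_word
}.

HB.instance Definition _ k n := [isSub for @wball_word k n].
HB.instance Definition _ k n := [Finite of wball k n by <:].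

Definition wball_fg k n (w : wball k n) : free_group k := FreeGroup (valP w).

Section Groups.
Variable G : groupType.
Implicit Types (A H : set G) (f : G -> G).
Local Open Scope group_scope.

Definition subgroup H : Prop :=
  [/\ H 1, forall x y, H x -> H y -> H (x * y) & forall x, H x -> H x^-1].

Definition generated A : set G := smallest subgroup A.

Definition Aut : set (G -> G) :=
  [set f | bijective f /\ {morph f : x y / x * y}].

(* "Leaving H invariant" means f(H) = H, so that this is a subgroup of Aut. *)
Definition Aut_stab H : set (G -> G) := [set f | Aut f /\ f @` H = H].

Definition Inn H : set (G -> G) := [set (fun g => h * g * h^-1) | h in H].

Definition Aut_malnormal H : Prop :=
  forall f, Aut f -> (f @` H) `&` H <> [set 1] -> Inn H f.

End Groups.

Arguments Aut : clear implicits.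

Section Probability.
Variable R : realType.
Local Open Scope ring_scope.

Definition uniform_pr (T : finType) (E : set T) : R :=
  #|[set x : T | `[< E x >]]%SET|%:R / #|T|%:R.

Definition exponentially_generic (T : nat -> finType)
    (E : forall n, set (T n)) : Prop :=
  exists C kappa : R, [/\ 0 < C, 1 < kappa &
    forall n, uniform_pr (~` E n) <= C * kappa ^- n].

End Probability.

(* Independent uniform choices of w_1, ..., w_p in the ball amount to a uniform
   choice of the whole family. *)
Definition sample (k p n : nat) : finType := {ffun 'I_p -> wball k n}.

Definition sample_subgroup k p n (w : sample k p n) : set (free_group k) :=
  generated (range (fun i : 'I_p => wball_fg (w i))).

(* Main.v *)
Require Import Defs.
From HB Require Import structures.
From mathcomp Require Import all_boot all_order all_algebra.
From mathcomp Require Import all_classical reals sequences exp.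
From mathcomp Require Import zify lra.

Set Implicit Arguments.
Unset Strict Implicit.
Unset Printing Implicit Defensive.

(** Let [a] range over the letters (the basis and its inverses), let [alpha] be
    an automorphism of the free group, and let [P a] be the set of the elements
    [g] such that the reduced word of [alpha g] starts with [a]. In the Cayley
    tree of the image basis the edges are the translates of the boundaries of
    the sets [P a], so that twice the length of [alpha u] counts, over all [a],
    the elements [g] for which exactly one of [g] and [g * u] lies in [P a]
    ([separated_sum]). In the original Cayley tree [P a] is a two-colouring that
    does not separate neighbours far away, and its translates are crossed by the
    path that spells [u] at least at every turn of this path at which the two
    directions have different colours ([crossings_at]). If all turns, that is
    all reduced words of length two, occur about equally often in [u], a
    colouring that is not a half-tree is crossed by a definite proportion more
    often than the boundary of a half-tree ([cut_bound]). Hence either [alpha]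
    lengthens all long words with equidistributed turns ([length_increases]), or
    all the [P a] are half-trees; they are then the directions at a single
    vertex, and the inverse of [alpha] permutes the letters up to conjugation
    ([half_conj_perm]).

    Let now [H] be generated by words [w i] that are long, have equidistributed
    turns, and have no common block of length [L], a small proportion of [n],
    even up to inversion and permutation of the letters ([generic]). Few letters
    cancel in a reduced product of the [w i] and their inverses, so the reduced
    word of each non-trivial element of [H] is made of long pieces of the [w i]
    with short gaps ([syllables_survive]), and has equidistributed turns. If [f]
    maps [x0] in [H] to an element of [H] and both are non-trivial, then [f] and
    its inverse exchange the powers of [x0] and of [f x0], so they do not both
    lengthen long elements of [H]; thus [f] or its inverse is a permutation of
    the letters followed by the conjugation by some [v]. A large power of [x0]
    and its image share a long block up to the permutation; as blocks are not
    repeated, the permutation is trivial and the two occurrences of the block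
    are at the same place of the same [w i], which puts [v] in [H]
    ([conj_perm_spanned]).

    It remains to count ([words]). Short words are exponentially rare. So are
    words with too few turns of some kind: correcting the count of a turn by a
    solution of the Poisson equation of the chain of letters gives a martingale
    with bounded increments ([turn_deviation]). A repetition of blocks
    determines each letter of one of them, or of its second half, from earlier
    letters, or else excludes some letters from a block; this costs an
    exponential factor ([constrained_count]), against polynomially many choices
    of the positions. *)

(** * Free groups as reduced words *)

Section FreeGroupWords.
Local Open Scope group_scope.
Variable k : nat.
Implicit Types (a b c e : letter k) (s t : seq (letter k)).
Implicit Types (x y z u v : free_group k).

Lemma linv_neq a : linv a != a.
Proof. by case: a => i b; rewrite /linv xpair_eqE /= eqxx; case: b. Qed.

Lemma linv_inj : injective (@linv k).
Proof. exact: can_inj (@linvK k). Qed.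

Lemma winv_cat s t : winv (s ++ t) = winv t ++ winv s.
Proof. by rewrite /winv map_cat rev_cat. Qed.

Lemma winv_cons a s : winv (a :: s) = rcons (winv s) (linv a).
Proof. by rewrite /winv /= rev_cons. Qed.

Lemma winv_rcons s a : winv (rcons s a) = linv a :: winv s.
Proof. by rewrite /winv map_rcons rev_rcons. Qed.

Lemma size_winv s : size (winv s) = size s.
Proof. by rewrite /winv size_rev size_map. Qed.

Lemma reduced_catl s t : reduced (s ++ t) -> reduced s.
Proof. by move=> /cat_sorted2 []. Qed.

Lemma reduced_catr s t : reduced (s ++ t) -> reduced t.
Proof. by move=> /cat_sorted2 []. Qed.

Lemma reduced_glue s a b t :
  reduced (rcons s a ++ b :: t) =
  [&& reduced (rcons s a), b != linv a & reduced (b :: t)].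
Proof.
case: s => [|c s] //=; rewrite cat_path /= last_rcons.
by case: path.
Qed.

Lemma reduced_nseq m a : reduced (nseq m a).
Proof.
case: m => //= m; elim: m => //= m ->; rewrite andbT.
by rewrite eq_sym linv_neq.
Qed.

Lemma fg_inj x y : fg_word x = fg_word y -> x = y.
Proof. exact: val_inj. Qed.

Lemma fg_eq1 x : fg_word x = [::] -> x = 1.
Proof. by move=> E; apply: fg_inj. Qed.

Lemma fg_red x : reduced x. Proof. exact: valP. Qed.
Hint Resolve fg_red : core.

Lemma fg_wordM x y : fg_word (x * y) = reduce (x ++ y). Proof. by []. Qed.
Lemma fg_wordV x : fg_word x^-1 = winv x. Proof. by []. Qed.

Definition spell s : free_group k := FreeGroup (reduced_reduce s).

Lemma spell_cat s t : spell (s ++ t) = spell s * spell t.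
Proof. by apply: fg_inj; rewrite fg_wordM /= reduce_catl reduce_catr. Qed.

Lemma spellE x : spell x = x.
Proof. by apply: fg_inj; rewrite /= reduce_id. Qed.

Lemma spellK s : reduced s -> fg_word (spell s) = s.
Proof. exact: reduce_id. Qed.

Lemma spell_winv s : spell (winv s) = (spell s)^-1.
Proof.
apply/eqP; rewrite -mulg_eq1 -spell_cat; apply/eqP/fg_inj.
exact: reduce_Vmul.
Qed.

Definition fg_gen a : free_group k := spell [:: a].

Lemma fg_gen_linv a : fg_gen (linv a) = (fg_gen a)^-1.
Proof. by rewrite -spell_winv. Qed.

Lemma fg_gen_inj : injective fg_gen.
Proof.
move=> a b E; have /(congr1 (head a)) : [:: a] = [:: b] by exact (congr1 (@fg_word k) E).
by [].
Qed.

Lemma spell_cons a s : spell (a :: s) = fg_gen a * spell s.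
Proof. by rewrite -cat1s spell_cat. Qed.

Lemma spell_rcons s a : spell (rcons s a) = spell s * fg_gen a.
Proof. by rewrite -cats1 spell_cat. Qed.

Lemma fg_wordM_cat x y : reduced (x ++ y) -> fg_word (x * y) = x ++ y.
Proof. by move=> Hr; rewrite fg_wordM reduce_id. Qed.

Definition hd x := ohead (fg_word x).

Lemma hd_eq0 x : (hd x == None) = (x == 1).
Proof.
apply/idP/eqP => [|->] //.
by rewrite /hd; case E: (fg_word x) => [|a w] //= _; apply: fg_inj.
Qed.

Lemma hd_fg_gen a : hd (fg_gen a) = Some a. Proof. by []. Qed.

Lemma hdV_rcons x s a : fg_word x = rcons s a -> hd x^-1 = Some (linv a).
Proof. by rewrite /hd fg_wordV => ->; rewrite winv_rcons. Qed.

Definition nocancel x y := (hd x^-1 == None) || (hd x^-1 != hd y).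

Lemma nocancel_red x y : nocancel x y -> reduced (x ++ y).
Proof.
rewrite /nocancel; have [-> _|] := eqVneq x 1; first exact: (fg_red y).
case/lastP E : (fg_word x) => [|s a] x1; first by move: (fg_eq1 E) x1 => -> //; rewrite eqxx.
rewrite (hdV_rcons E) /= => nc; have := fg_red x; rewrite E => rx.
move: nc; rewrite /hd; have := fg_red y; case: (fg_word y) => [|b t] ry /=.
  by rewrite cats0.
by rewrite reduced_glue rx ry => nc; rewrite andbT; apply: contra nc => /eqP->.
Qed.

Lemma fg_nocancel x y : nocancel x y -> fg_word (x * y) = x ++ y.
Proof. by move=> /nocancel_red/fg_wordM_cat. Qed.

Lemma hd_nocancel x y : nocancel x y -> x != 1 -> hd (x * y) = hd x.
Proof.
move=> /fg_nocancel E; rewrite -hd_eq0 /hd E.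
by case: (fg_word x).
Qed.

Lemma size_nocancel x y : nocancel x y -> size (x * y) = (size x + size y)%N.
Proof. by move=> /fg_nocancel ->; rewrite size_cat. Qed.

Lemma nocancelV x y : nocancel x y -> nocancel y^-1 x^-1.
Proof.
rewrite /nocancel invgK; have [<-|_] := eqVneq (hd y) (hd x^-1).
  by rewrite orbF.
by rewrite !orbT.
Qed.

Lemma nocancelMl x y z : nocancel x y -> y != 1 -> nocancel (x * y) z = nocancel y z.
Proof. by move=> nc y1; rewrite /nocancel invgM hd_nocancel ?invg_eq1 ?nocancelV. Qed.

Lemma nocancelMr x y z : nocancel y z -> y != 1 -> nocancel x (y * z) = nocancel x y.
Proof. by move=> nc y1; rewrite /nocancel hd_nocancel. Qed.

Lemma fg_gen_neq1 a : fg_gen a != 1.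
Proof. by rewrite -hd_eq0. Qed.

(** The factor [c] that cancels is maximal, so what remains is already reduced. *)
Lemma cancelP x y : exists x1 c y1 : seq (letter k),
  [/\ fg_word x = x1 ++ winv c, fg_word y = c ++ y1 & fg_word (x * y) = x1 ++ y1].
Proof.
have H s t : reduced s -> reduced t -> exists s1 c t1 : seq (letter k),
   [/\ s = s1 ++ winv c, t = c ++ t1 & reduced (s1 ++ t1)].
  elim: t s => [|b t IHt] s rs rt.
    by exists s, [::], [::]; rewrite !cats0.
  case/lastP: s rs => [|s a] rs; first by exists [::], [::], (b :: t).
  have [eab|nab] := eqVneq b (linv a); last first.
    exists (rcons s a), [::], (b :: t); rewrite cats0; split => //.
    by rewrite reduced_glue rs nab.
  have rs' : reduced s by move: rs; rewrite -cats1 => /reduced_catl.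
  have [s1 [c [t1 [Es Et rst]]]] := IHt s rs' (path_sorted rt).
  exists s1, (b :: c), t1; split; rewrite ?Et //.
  by rewrite winv_cons eab linvK -rcons_cat -Es.
have [x1 [c [y1 [Ex Ey rxy]]]] := H _ _ (fg_red x) (fg_red y).
exists x1, c, y1; split => //.
have -> : x = spell x1 * (spell c)^-1 by rewrite -[LHS]spellE Ex spell_cat spell_winv.
have -> : y = spell c * spell y1 by rewrite -[LHS]spellE Ey spell_cat.
by rewrite mulgA mulgVK -spell_cat spellK.
Qed.

Lemma sizeM x y : size (x * y) <= size x + size y.
Proof.
have [x1 [c [y1 [-> -> ->]]]] := cancelP x y.
rewrite !size_cat size_winv; lia.
Qed.

Lemma sizeV x : size x^-1 = size x. Proof. by rewrite fg_wordV size_winv. Qed.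

Lemma sizeM_gel x y : size y <= size x + size (x * y).
Proof. by rewrite -{1}(mulKg x y) -(sizeV x) sizeM. Qed.

Lemma hd_long x y : size y < size x -> hd (x * y) = hd x.
Proof.
rewrite /hd; have [x1 [c [y1 [-> -> ->]]]] := cancelP x y.
rewrite !size_cat size_winv; case: x1 => //=; lia.
Qed.

Lemma size_eq0g x : (size x == 0) = (x == 1).
Proof.
apply/idP/eqP => [|->] // /nilP E; exact: fg_inj.
Qed.

Lemma fg_letter x a : hd x = Some a ->
  exists z, [/\ x = fg_gen a * z, fg_word x = a :: z & nocancel (fg_gen a) z].
Proof.
rewrite /hd; case E : (fg_word x) => [|b w] //= [<-].
have rw : reduced w by have := fg_red x; rewrite E => /path_sorted.
exists (spell w); rewrite spellK //; split => //.
  by rewrite -spell_cons -E spellE.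
rewrite /nocancel -fg_gen_linv hd_fg_gen /= /hd spellK //; move: (fg_red x); rewrite E.
by case: (w) => [|c w'] //= /andP[]; rewrite (inj_eq Some_inj) eq_sym.
Qed.

Definition letter_pow a m := spell (nseq m a).

Lemma letter_pow_word a m : fg_word (letter_pow a m) = nseq m a.
Proof. by rewrite spellK //; apply: reduced_nseq. Qed.

Lemma size_letter_pow a m : size (letter_pow a m) = m.
Proof. by rewrite letter_pow_word size_nseq. Qed.

Lemma hd_letter_pow a m : 0 < m -> hd (letter_pow a m) = Some a.
Proof. by rewrite /hd letter_pow_word; case: m. Qed.

Lemma expg_conj x y m : (y * x * y^-1) ^+ m = y * x ^+ m * y^-1.
Proof.
elim: m => [|m IHm]; first by rewrite !expg0 mulg1 mulgV.
by rewrite !expgS IHm !mulgA mulgVK.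
Qed.

(** Free groups have no torsion, in the form that powers get arbitrarily long:
    conjugating to a cyclically reduced word reduces to the case in which the
    successive powers concatenate without cancellation. *)
Lemma size_pow_unbounded x : x != 1 -> forall B, exists m, B <= size (x ^+ m).
Proof.
have [N] := ubnP (size x); elim: N x => // N IHN x leN x1 B.
have [nc|] := boolP (nocancel x x).
  have H m : 0 < m -> nocancel x (x ^+ m) /\ hd (x ^+ m) = hd x.
    elim: m => // [[|m]] IHm _; first by rewrite expg1.
    rewrite expgS; have [nc' E] := IHm isT.
    by rewrite /nocancel !hd_nocancel.
  have Hs m : m <= size (x ^+ m).
    elim: m => // [[|m]] IHm; first by rewrite expg1 lt0n size_eq0g.
    rewrite expgS size_nocancel ?(H _ _).1 //.
    have x_gt0 : 0 < size x by rewrite lt0n size_eq0g.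
    exact: (leq_add x_gt0 IHm).
  by exists B.
rewrite /nocancel negb_or negbK hd_eq0 invg_eq1 x1 /= => /eqP E.
case hx : (hd x) => [a|]; last by move/eqP: hx; rewrite hd_eq0 (negbTE x1).
have [y [ex wx _]] := fg_letter hx.
have y1 : y != 1.
  apply/eqP => y1; move: E; rewrite hx ex y1 mulg1 -fg_gen_linv hd_fg_gen => -[/eqP].
  by rewrite (negbTE (linv_neq a)).
case/lastP wy : (fg_word y) => [|s b].
  by move: y1; rewrite -size_eq0g wy.
have eb : b = linv a.
  move: E; rewrite hx (@hdV_rcons x (a :: s) b) => [[<-]|]; first by rewrite linvK.
  by rewrite wx wy rcons_cons.
have rs : reduced s by have := fg_red y; rewrite wy -cats1 => /reduced_catl.
have ez : x = (fg_gen a * spell s) * (fg_gen a)^-1.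
  by rewrite -fg_gen_linv -eb -mulgA -spell_rcons -wy spellE.
have [||m Hm] := IHN (spell s) _ _ (B + 2)%N.
- by move: leN; rewrite wx wy /= size_rcons reduce_id //; lia.
- apply: contra_neq (linv_neq a) => e; move: ez; rewrite e mulg1 mulgV => e1.
  by rewrite e1 eqxx in x1.
exists m; have -> : x ^+ m = fg_gen a * (spell s ^+ m) * (fg_gen a)^-1.
  by rewrite ez expg_conj.
have h1 := sizeM_gel (fg_gen a) (spell s ^+ m).
have h2 := sizeM ((fg_gen a * (spell s ^+ m)) * (fg_gen a)^-1) (fg_gen a).
have h3 : size (fg_gen a) = 1%N by [].
move: h1 h2; rewrite mulgVK h3; lia.
Qed.

End FreeGroupWords.

Arguments nocancel {k}.
#[global] Hint Resolve fg_red : core.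

(** * Colourings of the Cayley tree *)

Lemma fin_threshold (T : finType) (P : T -> nat -> Prop) :
  (forall a, exists M, forall m, M <= m -> P a m) ->
  exists M, forall a m, M <= m -> P a m.
Proof.
move=> /choice [f Hf]; exists (\max_a f a) => a m le_m.
by apply: Hf; apply: leq_trans le_m; exact: leq_bigmax.
Qed.

Section Colorings.
Local Open Scope group_scope.
Variable k : nat.
Notation F := (free_group k).
Variable C : eqType.
Implicit Types (a b c d : letter k) (x y z u v g : F) (A : F -> C) (K : letter k -> C).

(** Vertices of the Cayley tree of the basis are the elements themselves, and the
    direction [a] at the vertex [v] consists of the products [v * z] in which the
    word of [z] starts with [a]. Colourings only matter up to finitely many
    vertices: they stand for partitions of the ends of the tree. *)
Definition tame A := exists L, forall g b, L <= size g -> A (g * fg_gen b) = A g.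

Definition monochrome A v a (e : C) :=
  exists M, forall z, hd z = Some a -> M <= size z -> A (v * z) = e.

Definition star A v K := forall a, monochrome A v a (K a).

Definition leaf A v b K :=
  (forall a, a != b -> monochrome A v a (K a)) /\
  exists a1 a2, [/\ a1 != b, a2 != b & K a1 != K a2].

Lemma tame_cone A v : tame A -> exists N, forall z y,
  N <= size z -> nocancel z y -> A (v * z * y) = A (v * z).
Proof.
case=> L HL; exists (L + size v)%N => z y le_z /nocancel_red.
rewrite -{2}[y]spellE; elim/last_ind: (fg_word y) => [|s b IHs] r.
  by rewrite (_ : spell _ = 1) ?mulg1 //; apply: fg_inj.
have r' : reduced (z ++ s) by move: r; rewrite -cats1 catA => /reduced_catl.
rewrite spell_rcons mulgA HL ?IHs //.
have h1 : size (z * spell s) = (size z + size s)%N.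
  by rewrite -{1}[z]spellE -spell_cat spellK // size_cat.
have h2 := sizeM_gel v (z * spell s).
rewrite -mulgA; move: h1 h2 le_z.
move: (size (z * _)) (size (v * _)) (size z) => *; lia.
Qed.

Lemma monochrome_unique A v a e e' : monochrome A v a e -> monochrome A v a e' -> e = e'.
Proof.
move=> [M HM] [M' HM']; pose z := letter_pow a (M + M').+1.
have hz : hd z = Some a by rewrite hd_letter_pow.
by rewrite -(HM z) ?(HM' z) // size_letter_pow; lia.
Qed.

(** All directions at [v1] but the one leading to [v] lie in a single direction
    at [v], so they inherit its colour. *)
Lemma monochrome_shift A v v1 d f e :
  monochrome A v f e -> hd (v^-1 * v1) = Some f -> hd (v1^-1 * v) != Some d ->
  monochrome A v1 d e.
Proof.
move=> [M HM] Ef Ed; exists M => z hz le_z.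
have nc : nocancel (v^-1 * v1) z by rewrite /nocancel invgM invgK hz Ed orbT.
rewrite -[v1](mulVKg v) -mulgA HM //.
  rewrite hd_nocancel // -hd_eq0 Ef //.
by rewrite size_nocancel //; lia.
Qed.

Lemma leaf_search_aux A v : tame A -> exists N, forall m z, z != 1 ->
  N <= size z + m ->
  (exists e, exists M, forall y, nocancel z y -> M <= size y -> A (v * z * y) = e)
  \/ exists y b K, [/\ nocancel z y, hd (z * y)^-1 = Some b & leaf A (v * z * y) b K].
Proof.
move=> /(@tame_cone A v) [N HN]; exists N; elim=> [|m IHm] z z1 le_N.
  left; exists (A (v * z)), 0%N => y nc _; apply: HN => //; lia.
case hb : (hd z^-1) => [b|]; last first.
  by move/eqP: hb; rewrite hd_eq0 invg_eq1 (negbTE z1).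
have nc_gl c : c != b -> nocancel z (fg_gen c).
  by move=> cb; rewrite /nocancel hb hd_fg_gen (inj_eq Some_inj) (eq_sym b) cb orbT.
have s_gl c : c != b -> size (z * fg_gen c) = (size z).+1.
  by move=> cb; rewrite size_nocancel ?nc_gl // addn1.
have [[c [y [b' [K [cb nc hb' lf]]]]]|noleaf] := pselect (exists c y b' K,
    [/\ c != b, nocancel (z * fg_gen c) y, hd (z * fg_gen c * y)^-1 = Some b'
      & leaf A (v * (z * fg_gen c) * y) b' K]).
  right; exists (fg_gen c * y), b', K; rewrite !mulgA in hb' lf *; split => //.
  by rewrite nocancelMr ?fg_gen_neq1 ?nc_gl //; move: nc; rewrite nocancelMl ?fg_gen_neq1 ?nc_gl.
have Hc c : exists e, c != b -> monochrome A (v * z) c e.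
  have [->|cb] := eqVneq c b; first by exists (A 1).
  (* At distance at least [N] from [v] all is constant, so going one step away
     from [v] decreases the part [m] of the distance that is left. *)
  have [||[e [M HM]]|[y [b' [K [nc hb' lf]]]]] := IHm (z * fg_gen c).
  - by rewrite -size_eq0g s_gl.
  - by rewrite s_gl //; lia.
  - exists e => _; exists M.+1 => y /fg_letter [w [Ey Wy ncw]] le_y.
    rewrite Ey mulgA -(mulgA v); apply: HM; last by move: le_y; rewrite Wy.
    by rewrite nocancelMl ?fg_gen_neq1 ?nc_gl.
  by case: noleaf; exists c, y, b', K.
have [K HK] := choice Hc.
have [[a1 [a2 H12]]|const] := pselect (exists a1 a2, [/\ a1 != b, a2 != b & K a1 != K a2]).
  right; exists 1, b, K; rewrite !mulg1; split=> //.
    by rewrite /nocancel hb.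
  by split; [exact: HK|exists a1, a2].
left; have [a0 Ha0] : exists a0, a0 != b by exists (linv b); exact: linv_neq.
exists (K a0).
have [|M HM] := @fin_threshold (letter k)
    (fun a m => a != b -> forall y, hd y = Some a -> size y = m -> A (v * z * y) = K a0).
  move=> a; have [->|ab] := eqVneq a b; first by exists 0%N.
  have [M HM] := HK a ab; exists M => m' le_m _ y hy sy.
  rewrite HM ?sy //; apply/eqP; apply/negPn/negP => nK.
  by case: const; exists a, a0.
exists M.+1 => y nc le_y.
case hy : (hd y) => [a|]; last first.
  by move/eqP: hy le_y; rewrite hd_eq0 => /eqP->.
apply: (HM a _ _ _ y hy erefl); first exact: ltnW.
by move: nc; rewrite /nocancel hb hy (inj_eq Some_inj) (eq_sym b).
Qed.

(** One moves away from [v] through directions that are not eventually constant.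
    Tameness stops this at some distance, at a vertex all of whose further
    directions are eventually constant, but not all of the same colour. *)
Lemma leaf_search A v a : tame A ->
  (exists e, monochrome A v a e) \/
  exists z b K, [/\ hd z = Some a, hd z^-1 = Some b & leaf A (v * z) b K].
Proof.
move=> /(@leaf_search_aux A v) [N HN].
have [||[e [M HM]]|[y [b [K [ncy hb lf]]]]] := HN N (fg_gen a).
- by rewrite -size_eq0g.
- by rewrite leq_addl.
- left; exists e, M.+1 => y hy le_y; have [w [Ey Wy ncw]] := fg_letter hy.
  rewrite Ey mulgA; apply: HM => //.
  by move: le_y; rewrite Wy.
right; exists (fg_gen a * y), b, K; split => //; last by rewrite mulgA.
by rewrite hd_nocancel // -size_eq0g.
Qed.

(** The vertices [v] and [v'] of the second case look at each other through the
    directions [b] and [b'] that are left out at them. *)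
Lemma star_or_leaves A : tame A ->
  (exists v K, star A v K) \/
  exists v b K v' b' K', [/\ leaf A v b K, leaf A v' b' K',
    hd (v^-1 * v') = Some b & hd (v'^-1 * v) = Some b'].
Proof.
move=> tA; have [H|] := pselect (forall a, exists e, monochrome A 1 a e).
  by left; exists 1; have [K HK] := choice H; exists K.
move=> /existsNP [a na]; have [//|[z [b [K [hz hb lf]]]]] := leaf_search 1 a tA.
rewrite mul1g in lf; have [[e me]|[y [b' [K' [hy hb' lf']]]]] := leaf_search z b tA.
  left; exists z, (fun c => if c == b then e else K c) => c.
  by case: eqVneq => [->|cb] //; apply: lf.1.
right; exists z, b, K, (z * y), b', K'; rewrite mulKg; split => //.
by rewrite invgM mulgVK.
Qed.

End Colorings.

(** * Counting the translates of a path that cross a colouring *)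

Definition turns (T : Type) (s : seq T) := zip s (behead s).

Section CountTurns.
Variable T : Type.
Implicit Types (s t : seq T) (D : pred (T * T)).

Lemma turns_cons2 (a b : T) s : turns [:: a, b & s] = (a, b) :: turns (b :: s).
Proof. by []. Qed.

Lemma size_turns s : size (turns s) = (size s).-1.
Proof. by rewrite size_zip size_behead; case: (size s) => // n; lia. Qed.

Lemma nth_turns (x : T) s i : i.+1 < size s ->
  nth (x, x) (turns s) i = (nth x s i, nth x s i.+1).
Proof.
by move=> lti; rewrite nth_zip_cond size_turns nth_behead; case: ltnP => //; lia.
Qed.

Lemma count_turns_cat D s t :
  count D (turns s) + count D (turns t) <= count D (turns (s ++ t)).
Proof.
elim: s => [|a [|b s] IHs] //; last first.
  by rewrite cat_cons cat_cons !turns_cons2 /= -addnA leq_add2l.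
by case: t {IHs} => //= c t; rewrite leq_addl.
Qed.

Lemma count_turns_catl D s t : count D (turns (s ++ t)) <= count D (turns s) + size t.
Proof.
elim: s => [|a [|b s] IHs].
- by rewrite (leq_trans (count_size _ _)) // size_turns; case: (size _).
- by rewrite (leq_trans (count_size _ _)) // size_turns.
by rewrite cat_cons cat_cons !turns_cons2 /= -addnA leq_add2l.
Qed.

Lemma count_turns_catr D s t : count D (turns (s ++ t)) <= size s + count D (turns t).
Proof.
elim: s => [|a s IHs] //; rewrite cat_cons.
case E : (s ++ t) => [|b r] //; rewrite turns_cons2 -E /= addSn.
by case: (D _) => /=; rewrite ?add1n ?ltnS // leqW.
Qed.

Lemma turns_rcons2 s (a b : T) :
  turns (rcons (rcons s a) b) = rcons (turns (rcons s a)) (a, b).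
Proof.
by elim: s => [|x [|y s] IHs] //; rewrite !rcons_cons turns_cons2 -!rcons_cons IHs.
Qed.

End CountTurns.

Lemma count_middle (T : Type) (D : pred T) s m :
  count D s <= count D (take (size s - 2 * m) (drop m s)) + 2 * m.
Proof.
rewrite -{1}(cat_take_drop m s) count_cat.
rewrite -{1}(cat_take_drop (size s - 2 * m) (drop m s)) count_cat.
have h1 := count_size D (take m s).
have h2 := count_size D (drop (size s - 2 * m) (drop m s)).
move: h1 h2; rewrite !size_drop size_take_min; lia.
Qed.

Section Crossings.
Local Open Scope group_scope.
Variable k : nat.
Notation F := (free_group k).
Implicit Types (a b c d : letter k) (x y z u v g : F) (A : F -> bool).
Implicit Types (K : letter k -> bool) (E : pred (letter k)).

Lemma count_turns_winv a b (s : seq (letter k)) :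
  count_mem (a, b) (turns (winv s)) = count_mem (linv b, linv a) (turns s).
Proof.
elim: s => [|x [|y s] IHs] //.
rewrite turns_cons2 !winv_cons turns_rcons2 -winv_cons -cats1 count_cat IHs /= addn0 addnC.
congr (nat_of_bool _ + _)%N; rewrite !xpair_eqE andbC.
by rewrite -(inj_eq (@linv_inj k) x) -(inj_eq (@linv_inj k) y) !linvK.
Qed.

Definition has_turns (tau : nat) (s : seq (letter k)) :=
  forall a b, b != linv a -> tau <= count_mem (a, b) (turns s).

Definition bichromatic E K : pred (letter k * letter k) :=
  [pred p | [&& E p.1, E p.2 & K p.1 != K p.2]].

(** The translation that moves a given turn of the path spelled by [u] to the
    vertex [v] makes the path start at some [g] and end at [g * u]. If the turn is at distance at least [m] from both ends of [u], the
    endpoints [g] and [g * u] have the colours of the two directions of the turn. *)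
Lemma crossings_at A v E K m u :
  (forall a, E a -> forall z, hd z = Some a -> m <= size z -> A (v * z) = K a) ->
  exists G : seq F, [/\ uniq G,
    {in G, forall g, A g != A (g * u)},
    {in G, forall g, exists2 a, E a & hd (v^-1 * g) = Some a} &
    count [pred p | bichromatic E K (linv p.1, p.2)] (turns u) <= size G + 2 * m].
Proof.
move=> HA; set D := [pred p | _]; pose n := size u.
have [[a0 _]|no_letter] := pselect (exists a : letter k, True); last first.
  exists [::]; split => //; have -> : fg_word u = [::].
    by case: (fg_word u) => // a s; case: no_letter; exists a.
  by [].
(* Turn number [i] takes place after [i.+1] letters. *)
pose f i := v * (spell (take i.+1 u))^-1.
pose I := [seq i <- iota m (n.-1 - 2 * m) | D (nth (a0, a0) (turns u) i)].
have HI i : i \in I -> [/\ m <= i, i.+1 + m < n &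
    bichromatic E K (linv (nth a0 u i), nth a0 u i.+1)].
  rewrite mem_filter mem_iota => /andP[Di /andP[le_i lt_i]].
  have lti : i.+1 < n by lia.
  by move: Di; rewrite nth_turns //= => ->; split => //; lia.
have rt i : reduced (take i u).
  by apply: (@reduced_catl _ _ (drop i u)); rewrite cat_take_drop.
have rd i : reduced (drop i u).
  by apply: (@reduced_catr _ (take i u)); rewrite cat_take_drop.
have hf i : i \in I -> hd (spell (take i.+1 u))^-1 = Some (linv (nth a0 u i)).
  move=> /HI[_ lti _]; apply: (@hdV_rcons _ _ (take i u)).
  by rewrite spellK // (take_nth a0) //; rewrite -/n; lia.
exists (map f I); split.
- rewrite map_inj_in_uniq ?filter_uniq ?iota_uniq // => i j /HI[_ li _] /HI[_ lj _].
  move=> /mulgI /invg_inj /(congr1 (size \o @fg_word k)) /=.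
  by rewrite !reduce_id // !size_takel; rewrite -/n; lia.
- move=> _ /mapP[i iI ->]; have [le_i lti /and3P[E1 E2 K12]] := HI i iI.
  have -> : f i * u = v * spell (drop i.+1 u).
    by rewrite -mulgA -{2}[u]spellE -{2}(cat_take_drop i.+1 u) spell_cat mulKg.
  rewrite (_ : A (f i) = K (linv (nth a0 u i))); last first.
    by apply: (HA _ E1); rewrite ?hf // sizeV spellK // size_takel -/n; lia.
  rewrite (_ : A (v * _) = K (nth a0 u i.+1)) //; apply: (HA _ E2).
    by rewrite /hd spellK // (drop_nth a0) //; rewrite -/n; lia.
  by rewrite spellK // size_drop -/n; lia.
- move=> _ /mapP[i iI ->]; have [_ _ /and3P[E1 _ _]] := HI i iI.
  by exists (linv (nth a0 u i)); rewrite // mulKg hf.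
have := count_middle D (turns u) m; rewrite size_turns -/n size_map size_filter.
have -> : take (n.-1 - 2 * m) (drop m (turns u)) =
          map (nth (a0, a0) (turns u)) (iota m (n.-1 - 2 * m)).
  apply: (@eq_from_nth _ (a0, a0)); rewrite ?size_map ?size_iota size_take_min size_drop size_turns -/n.
    lia.
  move=> i lti; rewrite (nth_map 0%N) ?size_iota; last by lia.
  by rewrite nth_take ?nth_drop ?nth_iota //; lia.
by rewrite count_map.
Qed.

Lemma count_has_turns tau s (D : pred (letter k * letter k)) :
  has_turns tau s -> (forall p, D p -> p.2 != linv p.1) ->
  #|D| * tau <= count D (turns s).
Proof.
move=> Ht HD; apply: (@leq_trans (\sum_(p in D) count_mem p (turns s))).
  rewrite -sum_nat_const; apply: leq_sum => -[x y] /HD; exact: Ht.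
elim: (turns s) => [|q t IHt] /=; first by rewrite big1.
rewrite big_split /= leq_add //.
have [Dq|nDq] := boolP (D q).
  rewrite (bigD1 q) //= eqxx big1 // => p /andP[_ pq].
  by rewrite eq_sym (negbTE pq).
rewrite big1 // => p Dp; case: eqVneq => // e.
by move: Dp; rewrite -e unfold_in (negbTE nDq).
Qed.

Lemma card_bichromatic E K :
  2 * (#|[set a | E a & K a]| * #|[set a | E a & ~~ K a]|) <=
  #|[pred p | bichromatic E K (linv p.1, p.2)]|.
Proof.
set X := [set a | E a & K a]%SET; set Y := [set a | E a & ~~ K a]%SET.
pose h (p : letter k * letter k) := (linv p.1, p.2).
have hK : involutive h by move=> [x y]; rewrite /h /= linvK.
have hI := inv_inj hK.
have dis : (finset.setX X Y :&: finset.setX Y X)%SET = finset.set0.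
  apply/setP => -[x y]; rewrite !finset.inE /=; case: (E x) (K x) => [] [];
    by rewrite ?andbF.
have := cardsUI (finset.setX X Y) (finset.setX Y X); rewrite dis cards0 addn0 !cardsX.
rewrite [(#|Y| * _)%N]mulnC addnn -mul2n => <-; rewrite -(card_imset _ hI).
apply: subset_leq_card; apply/fintype.subsetP => _ /imsetP[[x y] + ->].
rewrite finset.in_setU !finset.in_setX !finset.inE /= linvK /bichromatic /=.
by case: (E x); case: (E y); case: (K x); case: (K y).
Qed.

End Crossings.

Section Cuts.
Local Open Scope group_scope.
Variable k : nat.
Notation F := (free_group k).
Implicit Types (a b c d : letter k) (x y z u v g : F) (A : F -> bool).
Implicit Types (K : letter k -> bool) (E : pred (letter k)).

Lemma crossings_count A v E K m :
  (forall a, E a -> forall z, hd z = Some a -> m <= size z -> A (v * z) = K a) ->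
  forall u tau, has_turns tau u ->
  exists G : seq F, [/\ uniq G,
    {in G, forall g, A g != A (g * u)},
    {in G, forall g, exists2 a, E a & hd (v^-1 * g) = Some a} &
    2 * (#|[set a | E a & K a]%SET| * #|[set a | E a & ~~ K a]%SET|) * tau
      <= size G + 2 * m].
Proof.
move=> HA u tau Ht; have [G [uG sG hG cG]] := crossings_at u HA.
exists G; split=> //; apply: leq_trans cG.
apply: leq_trans (count_has_turns Ht _); first by rewrite leq_mul2r card_bichromatic orbT.
move=> [a b] /= /and3P[_ _]; apply: contraNneq => /= ->; exact: eqxx.
Qed.

(** Up to finitely many elements, a half-tree: the elements beyond some edge
    of the Cayley tree. *)
Definition half_tree A := exists v d (e : bool), star A v (fun a => e (+) (a != d)).

Lemma monochrome_threshold A K E v : (forall a, E a -> monochrome A v a (K a)) ->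
  exists m, forall a, E a -> forall z, hd z = Some a -> m <= size z -> A (v * z) = K a.
Proof.
move=> H; have [|m Hm] := @fin_threshold (letter k)
    (fun a m => E a -> forall z, hd z = Some a -> size z = m -> A (v * z) = K a).
  move=> a; case: (boolP (E a)) => [/H[m Hm]|_]; last by exists 0%N.
  by exists m => m' le_m _ z hz sz; apply: Hm; rewrite ?sz.
by exists m => a Ea z hz le_m; apply: Hm le_m Ea z hz erefl.
Qed.

Lemma card_split E K :
  (#|[set a | E a & K a]%SET| + #|[set a | E a & ~~ K a]%SET|)%N = #|[set a | E a]%SET|.
Proof.
rewrite -(cardsID [set a | K a]%SET [set a | E a]%SET).
by congr (_ + _)%N; apply: eq_card => a; rewrite !finset.inE // andbC.
Qed.

Lemma card_letter : #|{: letter k}| = (2 * k)%N.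
Proof. by rewrite card_prod card_ord card_bool mulnC. Qed.

Lemma add_le_mul m n : 0 < m -> 0 < n -> m + n - 1 <= m * n.
Proof. by case: m n => // m [] // n _ _; nia. Qed.

(** Two leaves, or a vertex whose [2 * k] directions are split into two parts with
    at least two elements, have at least [8 * k - 8] pairs of directions of
    different colours, each giving about [tau] crossings; a vertex next to the
    boundary of a half-tree has [4 * k - 2] of them. *)
Lemma cut_bound A : 1 < k -> tame A ->
  (forall (e : bool) B, exists2 g : F, B <= size g & A g = e) ->
  exists w M, [/\ 2 * (2 * k - 1) <= w, half_tree A \/ 8 * k - 8 <= w &
    forall u tau, has_turns tau u -> exists G : seq F, [/\ uniq G,
      {in G, forall g, A g != A (g * u)} & w * tau <= size G + M]].
Proof.
move=> k_gt1 tA ncA; have [[v [K sK]]|] := star_or_leaves tA.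
  have [m Hm] := @monochrome_threshold A K predT v (fun a _ => sK a).
  pose N1 := #|[set a | predT a & K a]%SET|; pose N2 := #|[set a | predT a & ~~ K a]%SET|.
  have HN : (N1 + N2 = 2 * k)%N.
    by rewrite card_split cardsE -card_letter.
  have Hcol e : exists a, K a = e.
    have [g le_g Ag] := ncA e (m + size v).+1.
    have le_m : m < size (v^-1 * g).
      by have := sizeM_gel v^-1 g; rewrite sizeV; set n := size (v^-1 * g); move: le_g; lia.
    case hz: (hd (v^-1 * g)) => [a|]; last first.
      by move/eqP: hz le_m; rewrite hd_eq0 => /eqP ->.
    exists a; rewrite -Ag -(mulVKg v g); symmetry; exact: Hm (ltnW le_m).
  have N1_gt0 : 0 < N1.
    by have [a Ka] := Hcol true; apply/card_gt0P; exists a; rewrite finset.inE /= Ka.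
  have N2_gt0 : 0 < N2.
    by have [a Ka] := Hcol false; apply/card_gt0P; exists a; rewrite finset.inE /= Ka.
  exists (2 * (N1 * N2))%N, (2 * m)%N; split.
  - by have := add_le_mul N1_gt0 N2_gt0; rewrite HN; clear; lia.
  - have [/eqP/cards1P[d Ed]|N1_neq1] := eqVneq N1 1%N.
      left; exists v, d, true => a; have := sK a; congr monochrome.
      have : (a \in [set a | predT a & K a]%SET) = (a == d) by rewrite Ed finset.inE.
      by rewrite finset.inE /= => ->; case: eqP.
    have [/eqP/cards1P[d Ed]|N2_neq1] := eqVneq N2 1%N.
      left; exists v, d, false => a; have := sK a; congr monochrome.
      have : (a \in [set a | predT a & ~~ K a]%SET) = (a == d) by rewrite Ed finset.inE.
      by rewrite finset.inE /=; case: (K a); case: eqP.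
    right; have : 2 * (N1 + N2 - 2) <= N1 * N2.
      case: (N1) (N2) N1_gt0 N2_gt0 N1_neq1 N2_neq1 => [|[|p]] // [|[|q]] // _ _ _ _; nia.
    by rewrite HN; clear; lia.
  - move=> u tau Ht; have [G [uG sG _ cG]] := crossings_count Hm Ht.
    by exists G.
move=> [v [b [K [v' [b' [K' [[mK [a1 [a2 [n1 n2 K12]]]] [mK' [a1' [a2' [n1' n2' K12']]]] hb hb']]]]]]].
have [m Hm] := @monochrome_threshold A K (predC1 b) v mK.
have [m' Hm'] := @monochrome_threshold A K' (predC1 b') v' mK'.
have HN (b0 c1 c2 : letter k) K0 : c1 != b0 -> c2 != b0 -> K0 c1 != K0 c2 ->
    4 * k - 4 <= 2 * (#|[set a | predC1 b0 a & K0 a]%SET| * #|[set a | predC1 b0 a & ~~ K0 a]%SET|).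
  move=> d1 d2 dK; have := card_split (predC1 b0) K0.
  have -> : #|[set a | predC1 b0 a]%SET| = (2 * k - 1)%N.
    by rewrite cardsE cardC1 card_letter subn1.
  set N1 := #|_|; set N2 := #|_| => HN.
  have N1_gt0 : 0 < N1.
    apply/card_gt0P; case K1: (K0 c1); [exists c1|exists c2]; rewrite finset.inE /= ?d1 ?d2 //.
    by move: dK; rewrite K1; case: (K0 c2).
  have N2_gt0 : 0 < N2.
    apply/card_gt0P; case K1: (K0 c1); [exists c2|exists c1]; rewrite finset.inE /= ?d1 ?d2 ?K1 //.
    by move: dK; rewrite K1; case: (K0 c2).
  by have := add_le_mul N1_gt0 N2_gt0; rewrite HN; clear; lia.
exists ((4 * k - 4) + (4 * k - 4))%N, (2 * m + 2 * m')%N; split.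
- by move: k_gt1; clear; lia.
- by right; move: k_gt1; clear; lia.
move=> u tau Ht; have [G [uG sG hG cG]] := crossings_count Hm Ht.
have [G' [uG' sG' hG' cG']] := crossings_count Hm' Ht.
exists (G ++ G'); split.
- (* Seen from [v], a path starting beyond [v'] starts in the direction [b]. *)
  rewrite cat_uniq uG uG' andbT; apply/hasPn => g /hG' [a' /= a'b' ha'].
  apply/negP => /hG [a /= ab ha]; case/negP: ab; rewrite -(inj_eq Some_inj) -ha -hb.
  rewrite -[g](mulVKg v') mulgA hd_nocancel //.
    by rewrite /nocancel invgM invgK hb' ha' (inj_eq Some_inj) (eq_sym b') a'b' orbT.
  by rewrite -hd_eq0 hb.
- by move=> g; rewrite mem_cat => /orP[/sG|/sG'].
rewrite size_cat.
rewrite mulnDl addnACA; apply: leq_add.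
  exact: leq_trans (leq_mul (HN _ _ _ _ n1 n2 K12) (leqnn tau)) cG.
exact: leq_trans (leq_mul (HN _ _ _ _ n1' n2' K12') (leqnn tau)) cG'.
Qed.

(** * The length of a product as a count of separating edges *)

(** Along the path from [g] to [g * spell s], the first letter changes from or to
    [a] only at a step between the origin and the vertex [fg_gen a]; the step
    number being given, this happens for one value of [g] only. *)
Lemma separated_count a (s : seq (letter k)) (G : seq F) : uniq G ->
  {in G, forall g, (hd g == Some a) != (hd (g * spell s) == Some a)} ->
  size G <= count_mem a s + count_mem (linv a) s.
Proof.
elim: s G => [|b s IHs] G uG HG.
  case: G uG HG => // g G _ /(_ g (mem_head _ _)).
  by rewrite (_ : spell _ = 1) ?mulg1 ?eqxx //; apply: fg_inj.
pose D g := (hd g == Some a) != (hd (g * fg_gen b) == Some a).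
have -> : size G = (size (seq.filter D G) + size (seq.filter (predC D) G))%N.
  by rewrite !size_filter count_predC.
have h1 : size [seq g <- G | D g] <= (b == a) + (b == linv a).
  apply: (@leq_trans (size (nseq (b == a) (1 : F) ++ nseq (b == linv a) (fg_gen a)))).
    apply: uniq_leq_size; first exact: filter_uniq.
    move=> g; rewrite mem_filter => /andP[Dg _]; rewrite mem_cat !mem_nseq.
    case: (ltngtP (size g) 1) => [||] sg.
    - have g1 : g = 1 by apply/eqP; rewrite -size_eq0g -leqn0.
      move: Dg; rewrite /D g1 mul1g /= hd_fg_gen (inj_eq Some_inj) eqxx andbT.
      by case: (b == a).
    - by move: Dg; rewrite /D (@hd_long _ g (fg_gen b)) ?eqxx.
    - have [c ec] : exists c, g = fg_gen c.
        have := spellE g; case: (fg_word g) sg => [|c []] // _ <-.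
        by exists c.
      move: Dg; rewrite /D ec hd_fg_gen (inj_eq Some_inj).
      have [eb|nb] := eqVneq b (linv c); last first.
        rewrite hd_nocancel ?fg_gen_neq1 // ?hd_fg_gen ?(inj_eq Some_inj) ?eqxx //.
        by rewrite /nocancel -fg_gen_linv !hd_fg_gen (inj_eq Some_inj) (eq_sym _ b) nb orbT.
      rewrite eb fg_gen_linv mulgV /=; case: (eqVneq c a) => [->|] // _.
      by rewrite !eqxx orbT.
  by rewrite size_cat !size_nseq.
have h2 : size [seq g <- G | predC D g] <= count_mem a s + count_mem (linv a) s.
  rewrite -(size_map (fun g => g * fg_gen b)); apply: IHs.
    by rewrite (map_inj_uniq (@mulIg _ (fg_gen b))) filter_uniq.
  move=> _ /mapP[g + ->]; rewrite mem_filter /= negbK => /andP[/eqP e gG].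
  by rewrite -e -mulgA -spell_cons HG.
by rewrite /= addnACA; apply: leq_add.
Qed.

Lemma sum_count_letters (s : seq (letter k)) : \sum_a count_mem a s = size s.
Proof.
elim: s => [|b s IHs] /=; first by rewrite big1.
rewrite big_split /= IHs (bigD1 b) //= eqxx big1 ?addn0 // => a.
by rewrite eq_sym => /negbTE->.
Qed.

Lemma separated_sum x (G : letter k -> seq F) : (forall a, uniq (G a)) ->
  (forall a, {in G a, forall g, (hd g == Some a) != (hd (g * x) == Some a)}) ->
  \sum_a size (G a) <= 2 * size x.
Proof.
move=> uG HG.
apply: (@leq_trans (\sum_a (count_mem a x + count_mem (linv a) x))).
  by apply: leq_sum => a _; apply: separated_count => // g /HG; rewrite spellE.
rewrite big_split /= sum_count_letters.
have <- : \sum_a count_mem a x = \sum_a count_mem (linv a) x.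
  exact: (reindex_inj (@linv_inj k)).
by rewrite sum_count_letters mul2n addnn.
Qed.

End Cuts.

(** * Automorphisms that do not lengthen equidistributed words *)

Section Letters.
Local Open Scope group_scope.
Variable k : nat.
Notation F := (free_group k).
Implicit Types (a b c d : letter k) (x y z u v g : F).

Lemma letter_avoid (s : seq (letter k)) : size s < 2 * k -> exists c, c \notin s.
Proof.
move=> lt_s; apply/existsP; rewrite -negb_forall; apply/negP => /forallP H.
have := card_size s; rewrite (eq_card (B := predT)) => [|c]; last exact: H.
by rewrite card_letter leqNgt lt_s.
Qed.

Lemma hd_fg_genM a y : (hd (fg_gen a * y) == Some a) = (hd y != Some (linv a)).
Proof.
have [hy|hy] := eqVneq (hd y) (Some (linv a)); last first.
  have nc : nocancel (fg_gen a) y by rewrite /nocancel -fg_gen_linv hd_fg_gen (eq_sym _ (hd y)) hy orbT.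
  by rewrite hd_nocancel ?fg_gen_neq1 // hd_fg_gen eqxx.
have [w [-> _]] := fg_letter hy; rewrite /nocancel fg_gen_linv invgK hd_fg_gen /= mulVKg.
by rewrite eq_sym => /negbTE.
Qed.

(** The hypothesis says that, up to finitely many elements, [x] maps the
    complement of the direction [b'] at the origin onto the direction [b]. It is
    tested on powers of letters, with enough letters to avoid cancellations. *)
Lemma translate_letter x b b' N : 1 < k ->
  (forall y, N <= size y -> (hd y == Some b) = (hd (x^-1 * y) != Some b')) ->
  x = fg_gen b.
Proof.
move=> k_gt1 H.
have Hl e : (e == b) = (hd (x^-1 * letter_pow e N.+1) != Some b').
  by rewrite -H ?size_letter_pow // hd_letter_pow // (inj_eq Some_inj).
case hx: (hd x) => [b0|]; last first.
  move/eqP: hx; rewrite hd_eq0 => /eqP x1.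
  have [e] := @letter_avoid [:: b; b'] ltac:(by move=> /=; lia).
  rewrite !inE negb_or => /andP[eb eb'].
  by have := Hl e; rewrite x1 invg1 mul1g hd_letter_pow // (inj_eq Some_inj) (negbTE eb) eb'.
have xV1 : x^-1 != 1 by rewrite invg_eq1 -hd_eq0 hx.
have Hnc e : e != b0 -> hd (x^-1 * letter_pow e N.+1) = hd x^-1.
  move=> eb0; rewrite hd_nocancel // /nocancel invgK hx hd_letter_pow //.
  by rewrite (inj_eq Some_inj) (eq_sym b0) eb0 orbT.
have eb0 : b0 = b.
  apply/eqP/negPn/negP => nb.
  have [e] := @letter_avoid [:: b; b0] ltac:(by move=> /=; lia).
  rewrite !inE negb_or => /andP[eb eb0].
  have := Hl e; rewrite Hnc // (negbTE eb) => /esym/negbFE/eqP E.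
  by have := Hl b; rewrite Hnc 1?eq_sym // E !eqxx.
move: hx; rewrite eb0 => hx.
have [w [Ew _ ncw]] := fg_letter hx.
case hw: (hd w) => [c|]; last first.
  by move/eqP: hw; rewrite hd_eq0 Ew => /eqP->; rewrite mulg1.
have w1 : w != 1 by rewrite -hd_eq0 hw.
have [e] := @letter_avoid [:: b; c; linv b] ltac:(by move=> /=; lia).
rewrite !inE !negb_or => /and3P[eb ec elb].
have E : hd x^-1 = Some b'.
  by have := Hl e; rewrite Hnc ?eb0 // (negbTE eb) => /esym/negbFE/eqP.
have nce : nocancel (fg_gen b) (letter_pow e N.+1).
  by rewrite /nocancel -fg_gen_linv hd_fg_gen hd_letter_pow // (inj_eq Some_inj) (eq_sym _ e) elb orbT.
have := H (fg_gen b * letter_pow e N.+1).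
rewrite size_nocancel // size_letter_pow leqW // => /(_ isT).
rewrite hd_nocancel ?fg_gen_neq1 // hd_fg_gen eqxx Ew invgM mulgA mulgVK.
have ncwe : nocancel w^-1 (letter_pow e N.+1).
  by rewrite /nocancel invgK hw hd_letter_pow // (inj_eq Some_inj) (eq_sym _ e) ec orbT.
rewrite hd_nocancel ?invg_eq1 //.
move: E; rewrite Ew invgM hd_nocancel ?invg_eq1 // ?nocancelV // => ->.
by rewrite eqxx.
Qed.

(** At each vertex, only one direction contains the edge bounding the half-tree. *)
Lemma half_shift (A : F -> bool) v : half_tree A ->
  exists d0 e, forall d, d != d0 -> monochrome A v d e.
Proof.
move=> [w [d [e sA]]]; have [->|vw] := eqVneq v w.
  by exists d, (~~ e) => d' nd; have := sA d'; rewrite nd addbT.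
case h1 : (hd (v^-1 * w)) => [d0|]; last first.
  by move/eqP: h1; rewrite hd_eq0 mulg_eq1 (inj_eq invg_inj) (negbTE vw).
case h2 : (hd (w^-1 * v)) => [f|]; last first.
  by move/eqP: h2; rewrite hd_eq0 mulg_eq1 (inj_eq invg_inj) eq_sym (negbTE vw).
exists d0, (e (+) (f != d)) => d' nd; apply: monochrome_shift (sA f) h2 _.
by rewrite h1 (inj_eq Some_inj) eq_sym.
Qed.

End Letters.

Section Automorphisms.
Local Open Scope group_scope.
Variable k : nat.
Hypothesis k_gt1 : 1 < k.
Notation F := (free_group k).
Implicit Types (a b c d : letter k) (x y z u v g : F).

Section Morphisms.
Variable f : F -> F.
Hypothesis fM : {morph f : x y / x * y}.

Lemma morph_fg1 : f 1 = 1.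
Proof. by apply: (@mulgI _ (f 1)); rewrite -fM !mulg1. Qed.

Lemma morph_fgV x : f x^-1 = (f x)^-1.
Proof. by apply: (@mulgI _ (f x)); rewrite -fM !mulgV morph_fg1. Qed.

Lemma morph_fgX x m : f (x ^+ m) = f x ^+ m.
Proof. by elim: m => [|m IHm]; rewrite ?expg0 ?morph_fg1 // !expgS fM IHm. Qed.

Lemma morph_lipschitz : exists B, forall x, size (f x) <= B * size x.
Proof.
exists (\max_a size (f (fg_gen a))) => x; rewrite -{1}[x]spellE.
elim: (fg_word x) => [|a s IHs].
  by rewrite (_ : spell _ = 1) ?morph_fg1 //; apply: fg_inj.
rewrite spell_cons fM mulnS; apply: leq_trans (sizeM _ _) _.
by apply: leq_add => //; exact: (leq_bigmax a).
Qed.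

End Morphisms.

Lemma morph_can (f h : F -> F) : {morph f : x y / x * y} -> cancel f h -> cancel h f ->
  {morph h : x y / x * y}.
Proof. by move=> fM fK hK x y; rewrite -{1}(hK x) -{1}(hK y) -fM fK. Qed.

Variables alpha beta : F -> F.
Hypothesis alphaM : {morph alpha : x y / x * y}.
Hypothesis alphaK : cancel alpha beta.
Hypothesis betaK : cancel beta alpha.

Let betaM := morph_can alphaM alphaK betaK.

(** The first letter of [alpha g] says in which direction the vertex [g] lies
    in the tree of the image basis, as seen from the origin. *)
Definition first_letter g := hd (alpha g).
Definition starts_with a g := first_letter g == Some a.

(** Multiplying [g] by a letter changes [alpha g] by a factor of bounded length,
    which cannot reach its first letter when [alpha g] is long. *)
Lemma tame_first_letter : tame first_letter.
Proof.
have [B HB] := morph_lipschitz betaM; have [B' HB'] := morph_lipschitz alphaM.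
exists (B * B').+1 => g b le_g; rewrite /first_letter alphaM hd_long //.
apply: (@leq_ltn_trans B').
  have sb : size (fg_gen b) = 1%N by [].
  by have := HB' (fg_gen b); rewrite sb muln1.
rewrite ltnNge; apply/negP => le_a.
have := HB (alpha g); rewrite alphaK leqNgt (leq_ltn_trans _ le_g) //.
by rewrite leq_mul2l le_a orbT.
Qed.

Lemma tame_starts_with a : tame (starts_with a).
Proof.
by have [L HL] := tame_first_letter; exists L => g b /HL; rewrite /starts_with => ->.
Qed.

Lemma starts_with_inf a B : exists2 g : F, B <= size g & starts_with a g.
Proof.
have [B' HB'] := morph_lipschitz alphaM.
exists (beta (letter_pow a (B' * B).+1)); last first.
  by rewrite /starts_with /first_letter betaK hd_letter_pow.
rewrite leqNgt; apply/negP => lt_B; have := HB' (beta (letter_pow a (B' * B).+1)).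
rewrite betaK size_letter_pow ltnNge; case/negP; rewrite leq_mul2l.
by rewrite (ltnW lt_B) orbT.
Qed.

Lemma starts_with_nonconst a (e : bool) B : exists2 g : F, B <= size g & starts_with a g = e.
Proof.
case: e; first exact: starts_with_inf.
have [g le_g] := starts_with_inf (linv a) B; rewrite /starts_with => /eqP hg.
by exists g => //; rewrite hg (inj_eq Some_inj) (negbTE (linv_neq a)).
Qed.

(** Among the [2 * k] letters, each contributes at least [4 * k - 2] times [tau]
    crossings and [a0] contributes at least [8 * k - 8] times [tau], which makes
    [8 * k ^ 2 - 6] in total. In a word with perfectly equidistributed turns,
    [2 * size u] is close to [(8 * k ^ 2 - 4 * k) * tau]: the hypothesis with the constant
    [8 * k ^ 2 - 7] leaves room for deviations. *)
Lemma length_increases a0 : ~ half_tree (starts_with a0) ->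
  exists B, forall u tau, has_turns tau u ->
    2 * size u <= (8 * k ^ 2 - 7) * tau -> B <= size u -> size u < size (alpha u).
Proof.
move=> nh.
have /choice [w Hw] : forall a, exists w, exists M, [/\ 2 * (2 * k - 1) <= w,
    half_tree (starts_with a) \/ 8 * k - 8 <= w &
    forall u tau, has_turns tau u -> exists G : seq F, [/\ uniq G,
      {in G, forall g, starts_with a g != starts_with a (g * u)}
      & w * tau <= size G + M]].
  by move=> a; apply: cut_bound => //; [apply: tame_starts_with|apply: starts_with_nonconst].
have {Hw}/choice [M HM] := Hw.
exists (8 * k ^ 2 * \sum_a M a).+1 => u tau Ht le_u lt_u.
have /choice [G HG] : forall a, exists G : seq F, [/\ uniq G,
      {in G, forall g, starts_with a g != starts_with a (g * u)}
      & w a * tau <= size G + M a].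
  by move=> a; have [_ _] := HM a; apply.
have ub : \sum_a size (G a) <= 2 * size (alpha u).
  have := @separated_sum k (alpha u) (fun a => map alpha (G a)).
  rewrite (eq_bigr (fun a => size (G a))); last by move=> a _; rewrite size_map.
  apply=> a; have [uG sG _] := HG a.
    by rewrite map_inj_uniq //; exact: can_inj alphaK.
  by move=> _ /mapP[g /sG + ->]; rewrite /starts_with /first_letter alphaM.
have lb : (\sum_a w a) * tau <= \sum_a size (G a) + \sum_a M a.
  by rewrite big_distrl -big_split; apply: leq_sum => a _; have [] := HG a.
have wb : 8 * k ^ 2 - 6 <= \sum_a w a.
  rewrite (bigD1 a0) //=; have [_ [//|w0] _] := HM a0.
  have : \sum_(a | a != a0) 2 * (2 * k - 1) <= \sum_(a | a != a0) w a.
    by apply: leq_sum => a _; have [] := HM a.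
  rewrite sum_nat_const cardC1 card_letter.
  move: w0 k_gt1; move: (w a0) (\sum_(a | _) _) => w0 s; clear; case: k => [|[|m]] //.
  by rewrite /expn /=; nia.
rewrite ltnNge; apply/negP => le_a.
have key : (8 * k ^ 2 - 6) * tau <= 2 * size u + \sum_a M a.
  apply: leq_trans (leq_trans (leq_mul wb (leqnn tau)) lb) _.
  by rewrite leq_add2r (leq_trans ub) // leq_mul2l le_a.
have le_tau : tau <= \sum_a M a.
  have e : 8 * k ^ 2 - 6 = (8 * k ^ 2 - 7).+1.
    by move: k_gt1; clear; case: k => [|[|m]] // _; rewrite /expn /=; nia.
  by move: key; rewrite e mulSn; lia.
have := leq_mul (leqnn (8 * k ^ 2 - 7)) le_tau.
have : (8 * k ^ 2 - 7) * \sum_a M a <= 8 * k ^ 2 * \sum_a M a by rewrite leq_mul2r leq_subr orbT.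
lia.
Qed.

Lemma monochrome_first_letter_neq0 v d : ~ monochrome first_letter v d None.
Proof.
move=> [M HM]; have := HM (letter_pow d (M + size v).+1); rewrite hd_letter_pow // size_letter_pow.
move=> /(_ erefl); rewrite -ltnS ltnW ?ltnS ?leq_addr // => /(_ isT) /eqP.
rewrite /first_letter hd_eq0 => /eqP E; have := congr1 beta E.
rewrite alphaK (morph_fg1 betaM) => /eqP; rewrite mulg_eq1 => /eqP Ev.
by have := congr1 (fun x => size (fg_word x)) Ev; rewrite sizeV size_letter_pow; lia.
Qed.

Lemma monochrome_starts_with v d e a : monochrome first_letter v d e ->
  monochrome (starts_with a) v d (e == Some a).
Proof. by move=> [M HM]; exists M => z hz le_z; rewrite /starts_with HM. Qed.

Lemma starts_with_monochrome v d a : monochrome (starts_with a) v d true ->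
  monochrome first_letter v d (Some a).
Proof. by move=> [M HM]; exists M => z hz le_z; apply/eqP; exact: HM. Qed.

(** If two coloured directions at [v] have the same colour [a], the half-tree of
    [a] contains all directions at [v] but one, which is already known to have
    another colour. Otherwise the coloured directions carry all letters but one,
    each in a half-tree contained in its direction, so the missing letter is the
    colour of the direction [b]. *)
Lemma leaf_star v b K : (forall a, half_tree (starts_with a)) -> leaf first_letter v b K ->
  exists a, monochrome (starts_with a) v b true.
Proof.
move=> hf [mK [a1 [a2 [n1 n2 K12]]]].
have Ksome d : exists a, d != b -> K d = Some a.
  have [->|db] := eqVneq d b; first by exists b.
  case E : (K d) => [a|]; first by exists a.
  by have := mK d db; rewrite E => /monochrome_first_letter_neq0.
have {Ksome}[K' HK'] := choice Ksome.
have mP d a : d != b -> monochrome (starts_with a) v d (K' d == a).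
  by move=> db; have := monochrome_starts_with a (mK d db); rewrite HK' // (inj_eq Some_inj).
have [injK|] := boolP (dinjectiveb K' (predC1 b)); last first.
  case/dinjectivePn => d1 /= d1b [d2] /andP[d21 d2b] eK.
  rewrite !inE in d1b d2b d21.
  exists (K' d1); have [d0 [e He]] := half_shift v (hf (K' d1)).
  have et : e = true.
    have [e0|ne0] := eqVneq d1 d0.
      have md2 : monochrome (starts_with (K' d1)) v d2 e by apply: He; rewrite -e0.
      by apply: (monochrome_unique md2); have := mP d2 (K' d1) d2b; rewrite -eK eqxx.
    by apply: (monochrome_unique (He _ ne0)); have := mP d1 (K' d1) d1b; rewrite eqxx.
  have [d3 d3b nK3] : exists2 d3, d3 != b & K' d3 != K' d1.
    have [e1|ne1] := eqVneq (K' a1) (K' d1); last by exists a1.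
    exists a2 => //; apply: contra K12 => /eqP e2; rewrite HK' // HK' // e1 e2 //.
  have e0 : d3 = d0.
    apply/eqP/negPn/negP => /He; have := mP d3 (K' d1) d3b.
    by rewrite (negbTE nK3) et => h1 h2; have := monochrome_unique h1 h2.
  by rewrite -et; apply: He; rewrite -e0 eq_sym.
move/dinjectiveP in injK.
pose Im := [set K' d | d in predC1 b]%SET.
have cIm : #|Im| = (2 * k - 1)%N.
  by rewrite card_in_imset // cardC1 card_letter subn1.
have /cards1P [c Ec] : #|~: Im|%SET == 1%N.
  by have := cardsC Im; rewrite cIm card_letter => E; apply/eqP; lia.
have mIm a : a \in Im -> monochrome (starts_with a) v b false.
  case/imsetP => d1; rewrite inE => d1b ->; set a0 := K' d1.
  have [d2] := @letter_avoid k [:: b; d1] ltac:(by move=> /=; lia).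
  rewrite !inE !negb_or => /andP[d2b d21].
  have [d3] := @letter_avoid k [:: b; d1; d2] ltac:(by move=> /=; lia).
  rewrite !inE !negb_or => /and3P[d3b d31 d32].
  have K2 : K' d2 != a0 by apply: contra d21 => /eqP /injK ->; rewrite ?inE.
  have K3 : K' d3 != a0 by apply: contra d31 => /eqP /injK ->; rewrite ?inE.
  have [d0 [e He]] := half_shift v (hf a0).
  have ef : e = false.
    have [e0|ne0] := eqVneq d2 d0.
      have md3 : monochrome (starts_with a0) v d3 e by apply: He; rewrite -e0.
      by apply: (monochrome_unique md3); have := mP d3 a0 d3b; rewrite (negbTE K3).
    by apply: (monochrome_unique (He _ ne0)); have := mP d2 a0 d2b; rewrite (negbTE K2).
  have e0 : d1 = d0.
    apply/eqP/negPn/negP => /He; have := mP d1 a0 d1b.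
    by rewrite eqxx ef => h1 h2; have := monochrome_unique h1 h2.
  by rewrite -ef; apply: He; rewrite -e0 eq_sym.
exists c.
have [|M HM] := @fin_threshold (letter k) (fun a m => a \in Im ->
    forall z, hd z = Some b -> size z = m -> starts_with a (v * z) = false).
  move=> a; have [/mIm[M HM]|_] := boolP (a \in Im); last by exists 0%N.
  by exists M => m le_m _ z hz sz; apply: HM; rewrite ?sz.
exists (M + size v).+1 => z hz le_z.
case E : (first_letter (v * z)) => [a|]; last first.
  move/eqP: E; rewrite /first_letter hd_eq0 => /eqP E; have := congr1 beta E.
  rewrite alphaK (morph_fg1 betaM) => /eqP; rewrite mulg_eq1 => /eqP Ev.
  by move: le_z; rewrite Ev sizeV; lia.
rewrite /starts_with E (inj_eq Some_inj).
have : a \in (~: Im)%SET.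
  rewrite finset.inE; apply/negP => aIm; have := HM a _ _ aIm z hz erefl.
  rewrite /starts_with E eqxx => /(_ _)/= H; suff: false by [].
  by symmetry; apply: H; lia.
by rewrite Ec finset.inE.
Qed.

(** By [leaf_star] there is a vertex [v] at which all directions have a colour. As
    all the [2 * k] letters occur as colours, they are in bijection with the
    directions at [v], and [translate_letter] computes [beta] from its action
    on these directions. *)
Lemma half_conj_perm : (forall a, half_tree (starts_with a)) ->
  exists v (sigma : letter k -> letter k),
    forall a, beta (fg_gen a) = v * fg_gen (sigma a) * v^-1.
Proof.
move=> hf.
have [v [K sK]] : exists v K, star first_letter v K.
  have [//|[v [b [K [_ [_ [_ [lf _ _ _]]]]]]]] := star_or_leaves tame_first_letter.
  have [c mc] := leaf_star hf lf; exists v, (fun a => if a == b then Some c else K a) => a.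
  by case: eqVneq => [->|ab]; [exact: starts_with_monochrome|exact: lf.1].
exists v.
have [M HM] : exists M, forall a z, hd z = Some a -> M <= size z ->
    first_letter (v * z) = K a.
  have [|M HM] := @fin_threshold (letter k)
    (fun a m => forall z, hd z = Some a -> size z = m -> first_letter (v * z) = K a).
    move=> a; have [M HM] := sK a; exists M => m le_m z hz sz.
    by apply: HM; rewrite ?sz.
  by exists M => a z hz le_z; apply: HM le_z z hz erefl.
have /choice [s Hs] : forall a, exists d, K d = Some a.
  move=> a; have [g le_g /eqP Pg] := starts_with_inf a (M + size v).+1.
  have le_m : M < size (v^-1 * g).
    by have := sizeM_gel v^-1 g; rewrite sizeV; set n := size (v^-1 * g); lia.
  case hz: (hd (v^-1 * g)) => [d|]; last first.
    by move/eqP: hz le_m; rewrite hd_eq0 => /eqP ->.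
  by exists d; rewrite -(HM _ _ hz (ltnW le_m)) mulVKg.
have injs : injective s by move=> a b e; apply: Some_inj; rewrite -!Hs e.
have sK' d a : (K d == Some a) = (d == s a).
  apply/eqP/eqP => [Kd|->]; last exact: Hs.
  have [h _ hK] := injF_bij injs; rewrite -[d](hK d) in Kd *.
  by move: Kd; rewrite Hs => -[->].
(* Left multiplication by [beta (fg_gen a)] sends the elements whose image does
   not start with [linv a] to those whose image starts with [a]. *)
exists s => a; set t := v^-1 * beta (fg_gen a) * v.
suff -> : fg_gen (s a) = t by rewrite /t -!mulgA mulgV mulg1 mulVKg.
symmetry; apply: (@translate_letter k t (s a) (s (linv a)) (M + size t).+1) => // y le_y.
have le_z : M < size (t^-1 * y).
  by have := sizeM_gel t^-1 y; rewrite sizeV; set n := size (t^-1 * y); lia.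
case hy : (hd y) => [d|]; last first.
  by move/eqP: hy le_y; rewrite hd_eq0 => /eqP ->.
case hz : (hd (t^-1 * y)) => [d'|]; last first.
  by move/eqP: hz le_z; rewrite hd_eq0 => /eqP ->.
rewrite !(inj_eq Some_inj) -!sK' -(HM _ _ hy); last by lia.
rewrite -(HM _ _ hz (ltnW le_z)) /first_letter -hd_fg_genM -(betaK (fg_gen a)) -alphaM.
by congr (hd (alpha _) == _); rewrite /t !invgM !invgK !mulgA mulgK mulgV mul1g.
Qed.

End Automorphisms.

(** * Subgroups generated by words without repeated blocks *)

Lemma dropl_cat (T : Type) n (s t : seq T) : n <= size s -> drop n (s ++ t) = drop n s ++ t.
Proof. by rewrite drop_cat leq_eqVlt => /orP[/eqP->|->] //; rewrite ltnn subnn drop0 drop_size. Qed.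

Lemma dropl_take (T : Type) d n (s : seq T) : d <= n -> drop d (take n s) = take (n - d) (drop d s).
Proof. by move=> le_dn; rewrite take_drop subnK. Qed.

Section Overlap.
Local Open Scope group_scope.
Variable k : nat.
Notation F := (free_group k).
Implicit Types (x y z u v : F) (s t : seq (letter k)).

Lemma mul_prefix v s t : reduced (s ++ t) -> size v <= size s ->
  fg_word (v * spell (s ++ t)) = fg_word (v * spell s) ++ t.
Proof.
move=> rst le_v; have [x1 [c [y1 [Ex Ey E]]]] := cancelP v (spell (s ++ t)).
have le_c : size c <= size s.
  by apply: leq_trans le_v; rewrite Ex size_cat size_winv leq_addl.
move: Ey; rewrite spellK // => Ey.
have Es : s = c ++ drop (size c) s.
  rewrite -{1}(cat_take_drop (size c) s); congr (_ ++ _).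
  by rewrite -[LHS](takel_cat t) // Ey take_size_cat.
have E1 : y1 = drop (size c) s ++ t.
  by move: Ey; rewrite {1}Es -catA => /(congr1 (drop (size c))); rewrite !drop_size_cat.
rewrite E E1 catA; congr (_ ++ _).
have -> : v * spell s = spell (x1 ++ drop (size c) s).
  rewrite {1}Es !spell_cat -{1}[v]spellE Ex spell_cat spell_winv.
  by rewrite mulgA mulgVK.
rewrite spellK //; have := fg_red (v * spell (s ++ t)); rewrite E E1 catA.
exact: reduced_catl.
Qed.

Lemma mul_suffix v s t : reduced (s ++ t) -> size v <= size t ->
  fg_word (spell (s ++ t) * v) = s ++ fg_word (spell t * v).
Proof.
move=> rst le_v.
have r : reduced (winv t ++ winv s) by rewrite -winv_cat reduced_winv.
have := @mul_prefix v^-1 (winv t) (winv s) r.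
rewrite sizeV size_winv -winv_cat !spell_winv -!invgM !fg_wordV => /(_ le_v).
by move/(congr1 (@winv k)); rewrite winv_cat !winvK.
Qed.

End Overlap.

Section Subgroup.
Local Open Scope group_scope.
Variables (k p : nat) (w : 'I_p -> free_group k).
Notation F := (free_group k).
Implicit Types (x y z u v e : F) (q : letter p).

Definition syllable q : F := if q.2 then w q.1 else (w q.1)^-1.

Lemma syllable_linv q : syllable (linv q) = (syllable q)^-1.
Proof. by case: q => i [] //=; rewrite /syllable /= invgK. Qed.

Definition eval_syl (s : seq (letter p)) : F := foldr (fun q x => syllable q * x) 1 s.

Lemma eval_syl_cat s t : eval_syl (s ++ t) = eval_syl s * eval_syl t.
Proof. by elim: s => [|q s IHs] /=; rewrite ?mul1g // IHs mulgA. Qed.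

Lemma eval_syl_winv s : eval_syl (winv s) = (eval_syl s)^-1.
Proof.
elim: s => [|q s IHs]; first by rewrite invg1.
by rewrite winv_cons -cats1 eval_syl_cat IHs /= mulg1 syllable_linv -invgM.
Qed.

Lemma eval_syl_push q s : eval_syl (push q s) = syllable q * eval_syl s.
Proof.
case: s => //= q' s; case: eqVneq => // ->.
by rewrite syllable_linv mulVKg.
Qed.

Lemma eval_syl_reduce s : eval_syl (reduce s) = eval_syl s.
Proof. by elim: s => //= q s IHs; rewrite eval_syl_push IHs. Qed.

Definition spanned : set F := range eval_syl.

Lemma spanned_mul x y : spanned x -> spanned y -> spanned (x * y).
Proof. by case=> s _ <- [t _ <-]; exists (s ++ t) => //; rewrite eval_syl_cat. Qed.

Lemma spanned_inv x : spanned x -> spanned x^-1.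
Proof. by case=> s _ <-; exists (winv s) => //; rewrite eval_syl_winv. Qed.

Lemma spanned1 : spanned 1. Proof. by exists [::]. Qed.

Lemma spannedX x m : spanned x -> spanned (x ^+ m).
Proof.
move=> Hx; elim: m => [|m IHm]; first by rewrite expg0; exact: spanned1.
by rewrite expgS; exact: spanned_mul.
Qed.

Lemma generated_spanned : generated (range w) = spanned.
Proof.
apply/seteqP; split.
  apply: smallest_sub.
    by split; [exact: spanned1|exact: spanned_mul|exact: spanned_inv].
  move=> _ [i _ <-]; exists [:: (i, true)] => //=.
  by rewrite /syllable /= mulg1.
move=> _ [s _ <-] H [[H1 HM HV] sH].
elim: s => [|q s IHs] //=; apply: HM => //; rewrite /syllable.
by case: ifP => _; [|apply: HV]; apply: sH; exists q.1.
Qed.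

Lemma spanned_reduced x : spanned x -> x != 1 ->
  exists q s, reduced (q :: s) /\ x = eval_syl (q :: s).
Proof.
case=> s _ <-; rewrite -eval_syl_reduce; have := reduced_reduce s.
by case: (reduce s) => [|q t] rt; rewrite /= ?eqxx // => _; exists q, t.
Qed.

Variable L : nat.

(** In [gen_long], the factor 12 leaves a length of [10 * L] to a syllable deprived
    of [L] letters at both ends. In [gen_turns], the term in [L] compensates for
    the turns lost with these letters, and [8 * k ^ 2 - 7] is the constant of
    [length_increases]. *)
Record generic : Prop := Generic {
  gen_pos : 0 < L;
  gen_long : forall q, 12 * L <= size (syllable q);
  gen_block : forall sigma : letter k -> letter k,
    injective sigma -> (forall a, sigma (linv a) = linv (sigma a)) ->
    forall q q' i j, i + L <= size (syllable q) -> j + L <= size (syllable q') ->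
    map sigma (take L (drop i (syllable q))) = take L (drop j (syllable q')) ->
    [/\ q = q', i = j & forall a, sigma a = a];
  gen_turns : forall q a b, b != linv a ->
    2 * size (syllable q) + (8 * k ^ 2 - 7) * (2 * L) <=
    (8 * k ^ 2 - 7) * count_mem (a, b) (turns (syllable q))
}.

Hypothesis gen : generic.

Definition core q : seq (letter k) := drop L (take (size (syllable q) - L) (syllable q)).

Lemma size_core q : size (core q) = (size (syllable q) - 2 * L)%N.
Proof. by rewrite size_drop size_take_min; lia. Qed.

Lemma core_long q : 10 * L <= size (core q).
Proof. by have := gen_long gen q; rewrite size_core; lia. Qed.

Lemma syllable_split q : fg_word (syllable q) =
  take L (syllable q) ++ core q ++ drop (size (syllable q) - L) (syllable q).
Proof.
have le := gen_long gen q.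
rewrite catA -{1}(cat_take_drop (size (syllable q) - L) (syllable q)); congr (_ ++ _).
rewrite -{1}(cat_take_drop L (take _ _)); congr (_ ++ _).
by rewrite take_takel //; lia.
Qed.

Lemma core_turns q a b : b != linv a ->
  2 * size (syllable q) <= (8 * k ^ 2 - 7) * count_mem (a, b) (turns (core q)).
Proof.
move=> ab; have le := gen_turns gen q ab; have le_q := gen_long gen q.
suff h : count_mem (a, b) (turns (syllable q)) <= count_mem (a, b) (turns (core q)) + 2 * L.
  by have := leq_mul (leqnn (8 * k ^ 2 - 7)) h; rewrite mulnDr; lia.
rewrite {1}syllable_split.
have h1 := count_turns_catr (pred1 (a, b)) (take L (syllable q))
   (core q ++ drop (size (syllable q) - L) (syllable q)).
have h2 := count_turns_catl (pred1 (a, b)) (core q) (drop (size (syllable q) - L) (syllable q)).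
have s1 : size (take L (syllable q)) = L by rewrite size_takel //; lia.
have s2 : size (drop (size (syllable q) - L) (syllable q)) = L by rewrite size_drop; lia.
apply: leq_trans h1 _; rewrite s1 mul2n -addnn addnA addnC leq_add2r; rewrite s2 in h2.
by [].
Qed.

(** The last condition says where the path of [y] is when it starts reading the
    core: up to an element of the subgroup, where the path of the syllable is. *)
Definition core_at (y : F) j q :=
  [/\ L <= j, take (size (core q)) (drop j y) = core q &
    exists2 e, spanned e & spell (take j y) = e * spell (take L (syllable q))].

Lemma core_at_size y j q : core_at y j q -> j + size (core q) <= size y.
Proof.
case=> _ E _; have := congr1 size E; rewrite size_take_min size_drop.
have := core_long q; have := gen_pos gen; lia.
Qed.

(** Less than [L] letters cancel between consecutive syllables, as otherwise the
    second one and the inverse of the first one would begin with the same block;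
    hence the cores survive in the reduced word of an element of the subgroup,
    with gaps of length at most [2 * L] between them. *)
Lemma syllables_survive q s : reduced (q :: s) -> let y := eval_syl (q :: s) in
  [/\ exists r, fg_word y = take (size (syllable q) - L) (syllable q) ++ r,
   forall a b, b != linv a ->
     2 * size y <= (8 * k ^ 2 - 7) * count_mem (a, b) (turns (drop L y)) &
   forall P, P + L <= size y -> exists j q', [/\ core_at y j q', j <= P + 2 * L
     & P <= j + size (core q')]].
Proof.
have first_core y q0 r : fg_word y = take (size (syllable q0) - L) (syllable q0) ++ r -> core_at y L q0.
  move=> Ey; have le := gen_long gen q0; split => //.
    rewrite Ey dropl_cat ?take_size_cat //; last by rewrite size_takel; lia.
  exists 1; first exact: spanned1.
  by rewrite Ey mul1g takel_cat ?take_takel // ?size_takel; lia.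
elim: s q => [|q2 s IHs] q rqs y.
  have le := gen_long gen q.
  have Ey : y = syllable q by rewrite /y /= mulg1.
  have E1 : fg_word y = take (size (syllable q) - L) (syllable q) ++ drop (size (syllable q) - L) (syllable q).
    by rewrite Ey cat_take_drop.
  split.
  - by exists (drop (size (syllable q) - L) (syllable q)).
  - move=> a b ab; rewrite Ey {2}syllable_split drop_size_cat ?size_takel //; last by lia.
    apply: leq_trans (core_turns q ab) _; rewrite leq_mul2l.
    by apply/orP; right; apply: leq_trans (count_turns_cat _ _ _); rewrite leq_addr.
  - move=> P leP; exists L, q; split; first exact: first_core E1.
      by lia.
    by move: leP; rewrite size_core Ey; lia.
have [nq rs] : q2 != linv q /\ reduced (q2 :: s) by move: rqs => /andP.
have [[r' Ey'] Ht' Hc'] := IHs q2 rs; set y' := eval_syl (q2 :: s) in Ey' Ht' Hc'.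
have Ey : y = syllable q * y' by [].
have evlE e : spanned e -> spanned (syllable q * e) by case=> t _ <-; exists (q :: t).
clearbody y y'.
have le := gen_long gen q; have le2 := gen_long gen q2.
have [x1 [c [y1 [Ex Ec E]]]] := cancelP (syllable q) y'; rewrite -Ey in E.
have lt_c : size c < L.
  rewrite ltnNge; apply/negP => le_c.
  have [] := @gen_block gen id (@inj_id _) (fun _ => erefl) (linv q) q2 0 0.
  - by rewrite syllable_linv sizeV; lia.
  - by lia.
  - rewrite map_id !drop0 syllable_linv fg_wordV Ex winv_cat winvK takel_cat //.
    rewrite -(takel_cat y1 le_c) -Ec Ey' takel_cat ?take_takel // ?size_takel; lia.
  by move=> e; rewrite e eqxx in nq.
have sx1 : size x1 = (size (syllable q) - size c)%N by rewrite Ex size_cat size_winv addnK.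
have E1 : fg_word y = take (size (syllable q) - L) (syllable q) ++ (drop (size (syllable q) - L) x1 ++ y1).
  rewrite E catA; congr (_ ++ _).
  rewrite -{1}(cat_take_drop (size (syllable q) - L) x1); congr (_ ++ _).
  rewrite -[LHS](takel_cat (winv c)); last by rewrite sx1; lia.
  by rewrite -Ex.
have sy : size y = (size x1 + size y' - size c)%N.
  by rewrite E Ec !size_cat; lia.
have occ_shift j q' : core_at y' j q' -> core_at y (size x1 + (j - size c)) q'.
  move=> [le_j Ej [e He Ee]]; have cj : size c <= j by lia.
  split; first by lia.
    rewrite E addnC -drop_drop drop_size_cat // -[RHS]Ej Ec; congr take.
    by rewrite drop_cat ltnNge cj.
  exists (syllable q * e); first exact: evlE.
  rewrite -mulgA -Ee -{1}[syllable q]spellE Ex spell_cat spell_winv.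
  rewrite E take_cat ltnNge leq_addr /= addKn spell_cat.
  by rewrite Ec take_cat ltnNge cj /= spell_cat mulgA mulgVK.
split.
- by eexists; exact: E1.
- move=> a b ab.
  have -> : drop L y = core q ++ (drop (size (syllable q) - L) x1 ++
      (take (L - size c) y1 ++ drop L y')).
    rewrite E1 dropl_cat ?size_takel; try lia; rewrite -/(core q).
    congr (_ ++ (_ ++ _)); rewrite -{1}(cat_take_drop (L - size c) y1); congr (_ ++ _).
    by rewrite Ec drop_cat ltnNge (ltnW lt_c).
  have h1 := core_turns q ab; have h2 := Ht' a b ab.
  have h3 := sizeM (syllable q) y'; rewrite -Ey in h3.
  set T := count_mem _ _.
  have : count_mem (a, b) (turns (core q)) + count_mem (a, b) (turns (drop L y')) <= T.
    rewrite /T; do 1?[apply: leq_trans (count_turns_cat _ _ _); rewrite leq_add2l].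
    apply: leq_trans (count_turns_cat _ _ _); apply: leq_trans (leq_addl _ _).
    by apply: leq_trans (count_turns_cat _ _ _); apply: leq_trans (leq_addl _ _).
  by move/(leq_mul (leqnn (8 * k ^ 2 - 7))); rewrite mulnDr; lia.
move=> P leP; have [le_P|lt_P] := leqP P (size (syllable q) - L).
  exists L, q; split; [exact: first_core E1|lia|rewrite size_core; lia].
have [le_P|lt_P'] := leqP P (size (syllable q)).
  have o := occ_shift _ _ (first_core _ _ _ Ey').
  have := core_long q2.
  by exists (size x1 + (L - size c))%N, q2; split => //; lia.
have [|j [q' [o le_j le_P]]] := Hc' (P - size x1 + size c)%N.
  by move: leP; rewrite sy; lia.
exists (size x1 + (j - size c))%N, q'; split; first exact: occ_shift.
  by lia.
by lia.
Qed.

Lemma spanned_cores y P : spanned y -> y != 1 -> P + L <= size y ->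
  exists j q, [/\ core_at y j q, j <= P + 2 * L & P <= j + size (core q)].
Proof. by move=> sy /(spanned_reduced sy)[q [s [/syllables_survive[_ _ H] ->]]] /H. Qed.

Lemma spanned_turns y a b : spanned y -> y != 1 -> b != linv a ->
  2 * size y <= (8 * k ^ 2 - 7) * count_mem (a, b) (turns y).
Proof.
move=> sy /(spanned_reduced sy)[q [s [/syllables_survive[_ H _] ->]]] /H H'.
apply: leq_trans H' _; rewrite leq_mul2l -{2}(cat_take_drop L (eval_syl _)).
by apply/orP; right; apply: leq_trans (count_turns_cat _ _ _); rewrite leq_addl.
Qed.

(** A conjugate of the image of a long [u] under a permutation of the letters
    still contains the image of some core of [u]; if the conjugate lies in the
    subgroup, this image overlaps one of its cores in a block of length [L].
    The blocks being pairwise different, both cores are the same and read at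
    the same place, so that the conjugating element joins two vertices of the
    tree that agree modulo the subgroup. *)
Lemma conj_perm_spanned sigma v u :
  injective sigma -> (forall a, sigma (linv a) = linv (sigma a)) ->
  spanned u -> spanned (v * spell (map sigma u) * v^-1) ->
  2 * size v + 4 * (\max_q size (syllable q)) < size u ->
  (forall a, sigma a = a) /\ spanned v.
Proof.
move=> injs sV su sy; set y := v * _ * _ in sy; set N := \max_q _ => lt_u.
have leN q : size (syllable q) <= N by apply: (leq_bigmax q).
have L_gt0 := gen_pos gen.
have red_map s : reduced s -> reduced (map sigma s).
  rewrite /reduced sorted_map; apply: sub_sorted => a b /=.
  by rewrite -sV (inj_eq injs).
have u1 : u != 1 by rewrite -size_eq0g -lt0n (leq_ltn_trans _ lt_u).
have [q0 _] := spanned_reduced su u1.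
have le_LN : 12 * L <= N by apply: leq_trans (leN q0); apply: gen_long.
have [|j [q [o le_j ge_j]]] := @spanned_cores u (size v + N) su u1; first by lia.
have cN : size (core q) <= N by rewrite size_core; have := leN q; lia.
have [_ Ecore [e1 He1 Ee1]] := o; have le_ju := core_at_size o.
set A := take j u in Ee1; set B := drop (size (core q)) (drop j u).
have Eu : fg_word u = A ++ (core q ++ B).
  rewrite -{1}(cat_take_drop j u); congr (_ ++ _).
  by rewrite -{1}(cat_take_drop (size (core q)) (drop j u)) Ecore.
have sA : size A = j by rewrite size_takel; lia.
have sB : size B = (size u - j - size (core q))%N by rewrite !size_drop.
have ru : reduced (map sigma A ++ (map sigma (core q) ++ map sigma B)).
  by rewrite -!map_cat -Eu; apply/red_map/fg_red.
pose A' := fg_word (v * spell (map sigma A)).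
pose B' := fg_word (spell (map sigma B) * v^-1).
have Ey1 : fg_word (v * spell (map sigma u)) = A' ++ (map sigma (core q) ++ map sigma B).
  by rewrite Eu !map_cat mul_prefix // size_map sA; lia.
have Ey : fg_word y = A' ++ (map sigma (core q) ++ B').
  rewrite /y -[v * _]spellE Ey1 catA mul_suffix -?catA //.
    by rewrite -Ey1; apply: fg_red.
  by rewrite sizeV size_map sB; lia.
have cq := core_long q.
have sy_ge : size A' + 10 * L <= size y by rewrite Ey !size_cat size_map; lia.
have y1 : y != 1 by rewrite -size_eq0g; lia.
have [|j2 [q2 [o2 le_j2 ge_j2]]] := @spanned_cores y (size A' + L) sy y1; first by lia.
have [_ Ecore2 [e2 He2 Ee2]] := o2; have cq2 := core_long q2.
pose m := maxn (size A') j2.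
have block_core q' i : i + L <= size (core q') ->
    take L (drop i (core q')) = take L (drop (L + i) (syllable q')).
  move=> le_i; have le := gen_long gen q'.
  rewrite (syllable_split q') addnC -drop_drop drop_size_cat; last by rewrite size_takel; lia.
  rewrite dropl_cat; last by lia.
  by rewrite takel_cat // (size_drop i (core q')); lia.
have B1 : take L (drop m y) = map sigma (take L (drop (L + (m - size A')) (syllable q))).
  rewrite -block_core; last by rewrite /m; lia.
  rewrite Ey drop_cat ltnNge leq_maxl /= dropl_cat; last by rewrite size_map /m; lia.
  rewrite takel_cat; last by rewrite size_drop size_map /m; lia.
  by rewrite map_take map_drop.
have B2 : take L (drop m y) = take L (drop (L + (m - j2)) (syllable q2)).
  rewrite -block_core; last by rewrite /m; lia.
  rewrite -[in RHS]Ecore2 dropl_take ?drop_drop; last by rewrite /m; lia.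
  rewrite take_takel; last by rewrite /m; lia.
  by rewrite subnK // leq_maxr.
have [] := @gen_block gen sigma injs sV q q2 (L + (m - size A')) (L + (m - j2)).
- by have := size_core q; have := gen_long gen q; rewrite /m; lia.
- by have := size_core q2; have := gen_long gen q2; rewrite /m; lia.
- by rewrite -B1.
move=> Eq Em Es; split=> //.
have Ej : size A' = j2 by move: Em; rewrite /m; lia.
have sid : map sigma A = A by rewrite (eq_map Es) map_id.
have : v * e1 = e2.
  apply: (@mulIg _ (spell (take L (syllable q)))).
  by rewrite -mulgA -Ee1 -{1}sid Eq -Ee2 -Ej Ey take_size_cat // /A' spellE.
move/(canRL (mulgK _)) => ->; apply: spanned_mul => //; exact: spanned_inv.
Qed.

End Subgroup.

Section Malnormal.
Local Open Scope group_scope.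
Variables (k p : nat) (w : 'I_p -> free_group k) (L : nat).
Hypotheses (k_gt1 : 1 < k) (p_gt0 : 0 < p) (gen : generic w L).
Notation F := (free_group k).
Implicit Types (f g : F -> F) (x y u v : F).

Lemma spanned_has_turns u : spanned w u -> u != 1 ->
  exists tau, has_turns tau u /\ 2 * size u <= (8 * k ^ 2 - 7) * tau.
Proof.
move=> su u1; set K := (8 * k ^ 2 - 7)%N.
have K_gt0 : 0 < K.
  by rewrite /K; move: k_gt1; clear; case: k => [|[|m]] // _; rewrite /expn /=; nia.
have h : 2 * size u < K * (2 * size u %/ K).+1 by rewrite [(K * _)%N]mulnC ltn_ceil.
have := spanned_turns gen su u1; rewrite -/K => Ht.
have [/dvdnP[m Em]|nd] := boolP (K %| 2 * size u).
  exists m; split; last by rewrite Em mulnC.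
  by move=> a b ab; rewrite -(leq_pmul2l K_gt0) mulnC -Em; exact: Ht.
exists (2 * size u %/ K).+1; split; last exact: ltnW.
move=> a b ab; rewrite ltn_divLR // [(_ * K)%N]mulnC; move: (Ht a b ab).
rewrite leq_eqVlt => /orP[/eqP E|//].
by case/negP: nd; rewrite E dvdn_mulr.
Qed.

Lemma conj_perm_conj f g x0 : {morph f : x y / x * y} -> cancel f g ->
  (exists v (sigma : letter k -> letter k), forall a, f (fg_gen a) = v * fg_gen (sigma a) * v^-1) ->
  spanned w x0 -> x0 != 1 -> spanned w (f x0) ->
  exists2 v, spanned w v & forall x, f x = v * x * v^-1.
Proof.
move=> fM fK [v [sigma Hs]] sx x1 sfx.
have injs : injective sigma.
  by move=> a b e; apply: fg_gen_inj; apply: (can_inj fK); rewrite !Hs e.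
have sV a : sigma (linv a) = linv (sigma a).
  apply: fg_gen_inj; apply: (@mulgI _ v); apply: (@mulIg _ v^-1).
  by rewrite -Hs fg_gen_linv (morph_fgV fM) Hs fg_gen_linv !invgM invgK mulgA.
have fE s : f (spell s) = v * spell (map sigma s) * v^-1.
  elim: s => [|a s IHs] /=.
    have e0 : spell [::] = 1 :> F by apply: fg_inj.
    by rewrite e0 (morph_fg1 fM) mulg1 mulgV.
  by rewrite !spell_cons fM IHs Hs !mulgA mulgVK.
have [m Hm] := size_pow_unbounded x1 (2 * size v + 4 * (\max_q size (syllable w q))).+1.
have [] := @conj_perm_spanned _ _ w L gen sigma v (x0 ^+ m) injs sV _ _ Hm.
- exact: spannedX.
- by rewrite -fE spellE (morph_fgX fM); apply: spannedX.
move=> sid sv; exists v => // x.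
by rewrite -[x in LHS]spellE fE (eq_map sid) map_id spellE.
Qed.

(** If neither [f] nor its inverse permutes the letters up to conjugation, both
    lengthen all long elements of the subgroup, but the powers of [x0] and of
    its image are mapped to each other. *)
Lemma aut_spanned_conj f x0 : Aut _ f -> spanned w x0 -> x0 != 1 -> spanned w (f x0) ->
  exists2 v, spanned w v & forall x, f x = v * x * v^-1.
Proof.
move=> [[g fK gK] fM] sx x1 sfx; have gM := morph_can fM fK gK.
have fx1 : f x0 != 1.
  by apply: contra_neq x1 => e; rewrite -(fK x0) e (morph_fg1 gM).
have [hf|/existsNP[a0 na0]] := pselect (forall a, half_tree (starts_with f a)).
  have gconj := half_conj_perm k_gt1 fM fK gK hf.
  have [|v sv Hv] := conj_perm_conj gM gK gconj sfx fx1; first by rewrite fK.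
  exists v^-1; first exact: spanned_inv.
  by move=> x; apply: (can_inj gK); rewrite fK Hv invgK !mulgA mulgK mulgV mul1g.
have [hg|/existsNP[a1 na1]] := pselect (forall a, half_tree (starts_with g a)).
  exact: conj_perm_conj fM fK (half_conj_perm k_gt1 gM gK fK hg) sx x1 sfx.
have [B HB] := length_increases k_gt1 fM fK gK na0.
have [B' HB'] := length_increases k_gt1 gM gK fK na1.
have [m Hm] := size_pow_unbounded x1 (B + B').+1.
have neX y : size y > 0 -> y != 1 by rewrite lt0n size_eq0g.
have [tau [Ht le_tau]] := spanned_has_turns (spannedX m sx) (neX _ (leq_ltn_trans (leq0n _) Hm)).
have lt1 : size (x0 ^+ m) < size (f (x0 ^+ m)) by apply: (HB _ _ Ht le_tau); lia.
have sX : spanned w (f (x0 ^+ m)) by rewrite (morph_fgX fM); apply: spannedX.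
have [tau' [Ht' le_tau']] := spanned_has_turns sX (neX _ (leq_ltn_trans (leq0n _) lt1)).
have := HB' _ _ Ht' le_tau'; rewrite fK ltnNge (ltnW lt1) => H.
by exfalso; move: (H ltac:(by lia)).
Qed.

Lemma generic_nontrivial : exists2 x, spanned w x & x != 1.
Proof.
pose q : letter p := (Ordinal p_gt0, true).
exists (syllable w q); first by exists [:: q]; rewrite //= mulg1.
by rewrite -size_eq0g -lt0n; have := gen_long gen q; have := gen_pos gen; lia.
Qed.

Lemma generic_malnormal : let H := generated (range w) in
  Aut_malnormal H /\ Aut_stab H = Inn H.
Proof.
move=> H; have EH : H = spanned w := generated_spanned w.
have mal : Aut_malnormal H.
  rewrite EH => f Af nt.
  have [y [x0 sx Ey] [sy y1]] : exists2 y, (f @` spanned w)%classic y & spanned w y /\ y <> 1.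
    apply: contrapT => no; apply: nt; apply/seteqP; split => [y [fy sy]|_ ->].
      by apply: contrapT => y1; apply: no; exists y.
    have [_ fM] := Af; split; last exact: spanned1.
    by exists 1; [exact: spanned1|exact: morph_fg1].
  have [||v sv Hv] := aut_spanned_conj Af sx.
  - apply/eqP => x1; apply: y1; rewrite -Ey x1; have [_ fM] := Af.
    exact: morph_fg1.
  - by rewrite Ey.
  by exists v => //; apply/funext => x; rewrite Hv.
split => //; apply/seteqP; split => [f [Af fH]|_ [v Hv <-]].
  apply: mal => // E; have [x sx /eqP x1] := generic_nontrivial; apply: x1.
  by move: E; rewrite fH setIid EH => E; move: sx; rewrite E.
have conjK (z x : F) : z * (z^-1 * x * z^-1^-1) * z^-1 = x.
  by rewrite invgK !mulgA mulgV mul1g mulgK.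
have conjK' (z x : F) : z^-1 * (z * x * z^-1) * z^-1^-1 = x.
  by rewrite invgK !mulgA mulVg mul1g mulgVK.
rewrite EH in Hv *; split.
  split; last by move=> x y; rewrite !mulgA mulgVK.
  by exists (fun x => v^-1 * x * v^-1^-1) => x; [exact: conjK'|exact: conjK].
apply/seteqP; split => [_ [x sx <-]|x sx].
  by do 2?apply: spanned_mul => //; apply: spanned_inv.
exists (v^-1 * x * v^-1^-1); last exact: conjK.
by do 2?apply: spanned_mul => //; rewrite ?invgK //; apply: spanned_inv.
Qed.

End Malnormal.

Import Order.TTheory GRing.Theory Num.Theory.

(** * Repeated blocks *)

Section Blocks.
Variables (k p : nat).
Hypothesis k_gt1 : 1 < k.
Implicit Types (a b c : letter k) (i j : 'I_p) (f : letter k -> letter k).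

Let a0 : letter k := (Ordinal (ltnW k_gt1), true).

(** The blocks starting at [x] and [y] are read in the same direction if [e] holds;
    otherwise [x] is the last position of the first block, read backwards. *)
Definition mirror (e : bool) (x y s : nat) := if e then (s + x - y)%N else (x + y - s)%N.

(** If [i = j], the letters that are copied have to come first, so that the block
    is determined by the letters of the word before it. *)
Definition copies m (W : 'I_p -> seq (letter k)) i j f e x y z :=
  (z + m <= size (W j)) &&
  [forall s : 'I_m, ((i == j) ==> (mirror e x y (z + s) < z + s)) &&
     (nth a0 (W j) (z + s) == f (nth a0 (W i) (mirror e x y (z + s))))].

Definition avoids m (W : 'I_p -> seq (letter k)) j c z :=
  (z + m <= size (W j)) &&
  [forall s : 'I_m, nth a0 (W j) (z + s) \notin [:: c; linv c]].

Section Matches.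
Variables (w : 'I_p -> free_group k) (n L : nat).
Hypothesis L_gt0 : 0 < L.
Hypothesis size_w : forall i, size (w i) <= n.
Let m := L./2.
Let W i := fg_word (w i).
Hypothesis no_copy : forall i j f e x y z, x <= n -> y <= n -> z <= n ->
  ~~ copies m W i j f e x y z.
Hypothesis no_avoid : forall j c z, z <= n -> ~~ avoids m W j c z.

(** Two blocks at the same place of the same word are equal up to [sigma] only if
    [sigma] fixes their letters, so that they avoid the letters it moves. *)
Lemma no_parallel sigma i j x y :
  injective sigma -> (forall a, sigma (linv a) = linv (sigma a)) ->
  x + L <= size (W i) -> y + L <= size (W j) ->
  (forall t, t < L -> nth a0 (W j) (y + t) = sigma (nth a0 (W i) (x + t))) ->
  [/\ i = j, x = y & forall a, sigma a = a].
Proof.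
move=> injs sV le_x le_y H; have xn : x <= n by have := size_w i; rewrite -/(W i); lia.
have yn : y <= n by have := size_w j; rewrite -/(W j); lia.
have mL : m <= L by rewrite /m; lia.
have ij : i = j.
  apply/eqP/negPn/negP => ij; case/negP: (@no_copy i j sigma true x y y xn yn yn).
  apply/andP; split; first by lia.
  apply/forallP => s; rewrite (negbTE ij) /mirror (_ : y + s + x - y = x + s)%N; last by lia.
  by rewrite -H ?eqxx //; apply: leq_trans mL.
subst j; have [h sK hK] := injF_bij injs.
have xy : x = y.
  case: (ltngtP x y) => // lt_xy; exfalso.
    case/negP: (@no_copy i i sigma true x y y xn yn yn).
    apply/andP; split; first by lia.
    apply/forallP => s; rewrite eqxx /mirror (_ : y + s + x - y = x + s)%N; last by lia.
    by rewrite ltn_add2r lt_xy -H ?eqxx //; apply: leq_trans mL.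
  case/negP: (@no_copy i i h true y x x yn xn xn).
  apply/andP; split; first by lia.
  apply/forallP => s; rewrite eqxx /mirror (_ : x + s + y - x = y + s)%N; last by lia.
  by rewrite ltn_add2r lt_xy H ?sK ?eqxx //; apply: leq_trans mL.
subst y; split => // c; apply/eqP/negPn/negP => nc.
case/negP: (@no_avoid i c x xn); apply/andP; split; first by lia.
apply/forallP => s; have := H s (leq_trans (ltn_ord s) mL).
set d := nth _ _ _ => Ed; rewrite !inE negb_or; apply/andP; split.
  by apply: contra nc => /eqP e; rewrite -e -Ed.
by apply: contra nc => /eqP e; rewrite -(inj_eq (@linv_inj k)) -sV -e -Ed.
Qed.

(** If the two blocks are in the same word, one letter of each compared pair comes
    first; for the second half of the block starting at [y], it is the letter in
    the block starting at [x]. This is the reason for the length [m]. *)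
Lemma no_antiparallel_le f i j x y : injective f ->
  x + L <= size (W i) -> y + L <= size (W j) -> (i = j -> x <= y) ->
  (forall t, t < L -> nth a0 (W j) (y + t) = f (nth a0 (W i) (x + (L - 1 - t)))) ->
  False.
Proof.
move=> injf le_x le_y le_xy H.
have xn : x + L - 1 <= n by have := size_w i; rewrite -/(W i); lia.
have yn : y <= n by have := size_w j; rewrite -/(W j); lia.
have zn : y + (L - m) <= n by have := size_w j; rewrite -/(W j); lia.
case/negP: (@no_copy i j f false (x + L - 1)%N y (y + (L - m))%N xn yn zn).
apply/andP; split; first by rewrite /m; lia.
apply/forallP => s; have sm := ltn_ord s; rewrite /mirror.
have ts : L - m + s < L by move: sm; rewrite /m; lia.
rewrite (_ : x + L - 1 + y - (y + (L - m) + s) = x + (L - 1 - (L - m + s)))%N; last by lia.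
rewrite -addnA -H // eqxx andbT; apply/implyP => /eqP /le_xy.
by move: sm ts; rewrite /m; lia.
Qed.

Lemma no_antiparallel f i j x y : injective f ->
  x + L <= size (W i) -> y + L <= size (W j) ->
  (forall t, t < L -> nth a0 (W j) (y + t) = f (nth a0 (W i) (x + (L - 1 - t)))) ->
  False.
Proof.
move=> injf le_x le_y H; have [le_xy|lt_yx] := leqP x y.
  exact: no_antiparallel_le injf le_x le_y _ H.
have [ij|ij] := eqVneq i j; last first.
  by apply: no_antiparallel_le injf le_x le_y _ H => e; rewrite e eqxx in ij.
subst j; have [h fK hK] := injF_bij injf.
apply: (@no_antiparallel_le h i i y x) => //; first exact: can_inj hK.
  by move=> _; apply: ltnW.
move=> t ltt; rewrite H; last by lia.
by rewrite fK; congr nth; lia.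
Qed.

Lemma nth_winv (s : seq (letter k)) t : t < size s ->
  nth a0 (winv s) t = linv (nth a0 s (size s - t.+1)).
Proof.
by move=> lt_t; rewrite /winv nth_rev ?size_map // (nth_map a0) //; lia.
Qed.

(** Up to inverting both syllables, a repetition of blocks is between two of the
    words [w i], or between one of them and the inverse of another. *)
Lemma no_repeated_block sigma : injective sigma ->
  (forall a, sigma (linv a) = linv (sigma a)) ->
  forall q q' x y, x + L <= size (syllable w q) -> y + L <= size (syllable w q') ->
  map sigma (take L (drop x (syllable w q))) = take L (drop y (syllable w q')) ->
  [/\ q = q', x = y & forall a, sigma a = a].
Proof.
move=> injs sV [i e] [j e'] x y le_x le_y E.
have H t : t < L -> nth a0 (syllable w (j, e')) (y + t) = sigma (nth a0 (syllable w (i, e)) (x + t)).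
  move=> ltt; have := congr1 (fun s => nth a0 s t) E.
  rewrite (nth_map a0) ?size_takel ?size_drop //; last by lia.
  by rewrite !nth_take // !nth_drop.
rewrite /syllable /= in le_x le_y H.
case: e e' {E} le_x le_y H => [] [] le_x le_y H.
- by have [-> ->] := no_parallel injs sV le_x le_y H.
- exfalso; rewrite sizeV in le_y.
  apply: (@no_antiparallel (@linv k \o sigma) i j x (size (W j) - y - L)) => //.
  + by apply: inj_comp => //; apply: linv_inj.
  + by rewrite /W; lia.
  move=> t ltt; have := H (L - 1 - t); rewrite fg_wordV nth_winv; last by lia.
  rewrite /= => <-; last by lia.
  by rewrite linvK /W; congr nth; lia.
- exfalso; rewrite sizeV in le_x.
  apply: (@no_antiparallel (sigma \o @linv k) i j (size (W i) - x - L) y) => //.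
  + by apply: inj_comp => //; apply: linv_inj.
  + by rewrite /W; lia.
  move=> t ltt; rewrite H // fg_wordV nth_winv; last by lia.
  by rewrite /= /W; congr (sigma (linv (nth _ _ _))); lia.
rewrite !sizeV in le_x le_y.
have [|||eij Exy sid] := @no_parallel sigma i j (size (W i) - x - L) (size (W j) - y - L) injs sV.
- by rewrite /W; lia.
- by rewrite /W; lia.
- move=> t ltt; apply: linv_inj; rewrite -sV.
  have := H (L - 1 - t); rewrite !fg_wordV !nth_winv; try lia.
  move=> h; have := h _; rewrite /W => {}h.
  rewrite (_ : size (w j) - y - L + t = size (w j) - (y + (L - 1 - t)).+1)%N; last by lia.
  rewrite (_ : size (w i) - x - L + t = size (w i) - (x + (L - 1 - t)).+1)%N; last by lia.
  by apply: h; lia.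
by subst j; split => //; move: Exy le_x le_y; rewrite /W; lia.
Qed.

End Matches.

End Blocks.

Local Open Scope ring_scope.

(** * Counting reduced words *)

Section Words.
Variable k : nat.
Implicit Types (s : seq (letter k)) (a b c : letter k).

Fixpoint words l : seq (seq (letter k)) :=
  if l is l'.+1 then
    flatten [seq [seq rcons s b | b <- enum {: letter k} & reduced (rcons s b)] | s <- words l']
  else [:: [::]].

Lemma reduced_rcons s c b :
  reduced (rcons (rcons s c) b) = reduced (rcons s c) && (b != linv c).
Proof. by rewrite -[rcons (rcons s c) b]cats1 reduced_glue andbT. Qed.

Lemma mem_words l s : (s \in words l) = reduced s && (size s == l).
Proof.
elim: l s => [|l IHl] s; first by rewrite inE; case: s => [|a s] //=; rewrite andbF.
apply/flatten_mapP/andP => [[t]|[]].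
  rewrite IHl => /andP[rt /eqP st] /mapP[b]; rewrite mem_filter => /andP[rb _] ->.
  by rewrite size_rcons st.
case/lastP: s => // t b rtb; rewrite size_rcons eqSS => st.
exists t; first by rewrite IHl st andbT; move: rtb; rewrite -cats1 => /reduced_catl.
by apply: map_f; rewrite mem_filter rtb mem_enum.
Qed.

Lemma uniq_words l : uniq (words l).
Proof.
elim: l => // l IHl /=.
elim: (words l) IHl => //= s W IHW /andP[sW /IHW uW].
rewrite cat_uniq uW andbT map_inj_uniq; last first.
  by move=> b c /eqP; rewrite eqseq_rcons => /andP[_ /eqP].
rewrite filter_uniq ?enum_uniq //=.
apply/hasPn => _ /flatten_mapP[t tW /mapP[b _ ->]].
apply/negP => /mapP[c _ /eqP]; rewrite eqseq_rcons => /andP[/eqP e _].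
by rewrite -e tW in sW.
Qed.

Lemma card_next s : (1 < k)%N -> reduced s ->
  #|[pred b | reduced (rcons s b)]| = (if s is [::] then 2 * k else 2 * k - 1)%N.
Proof.
move=> k_gt1; case/lastP: s => [_|s c rs].
  by rewrite -card_letter; apply: eq_card => b; rewrite !inE.
have -> : (if rcons s c is [::] then 2 * k else 2 * k - 1)%N = (2 * k - 1)%N.
  by case: (s).
rewrite subn1 -card_letter -(cardC1 (linv c)); apply: eq_card => b.
by rewrite !inE reduced_rcons rs.
Qed.

Section Weights.
Variable R : realType.

Lemma sum_words_step l (F : seq (letter k) -> R) :
  \sum_(s <- words l.+1) F s =
  \sum_(s <- words l) \sum_(b | reduced (rcons s b)) F (rcons s b).
Proof.
rewrite big_flatten /= big_map; apply: eq_bigr => s _.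
by rewrite big_map big_filter big_enum_cond.
Qed.

(** The bound for supermartingales: each letter multiplies the total weight by at
    most the corresponding factor. *)
Lemma sum_words_le (F : seq (letter k) -> R) (lam : nat -> R) l :
  (forall t, 0 <= lam t) ->
  (forall s, (size s < l)%N -> reduced s ->
     \sum_(b | reduced (rcons s b)) F (rcons s b) <= lam (size s) * F s) ->
  \sum_(s <- words l) F s <= (\prod_(t < l) lam t) * F [::].
Proof.
move=> lam_ge0; elim: l => [|l IHl] HF.
  by rewrite big_ord0 mul1r /= big_seq1.
rewrite sum_words_step big_ord_recr /= [_ * lam l]mulrC -mulrA.
apply: le_trans (_ : lam l * \sum_(s <- words l) F s <= _); last first.
  by apply: ler_wpM2l => //; apply: IHl => s lts; apply: HF; exact: ltnW.
rewrite mulr_sumr big_seq [X in _ <= X]big_seq; apply: ler_sum => s.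
by rewrite mem_words => /andP[rs /eqP sl]; rewrite -sl; apply: HF => //; rewrite sl.
Qed.

Definition growth : R := (2 * k - 1)%:R.
Notation q := growth.

Hypothesis k_gt1 : (1 < k)%N.

Lemma growth_ge3 : 3 <= q.
Proof. by rewrite /growth ler_nat; lia. Qed.

Lemma natr2k : (2 * k)%:R = q + 1 :> R.
Proof. by rewrite /growth natr1; congr (_%:R); lia. Qed.

Lemma sum_next s (F : seq (letter k) -> R) : reduced s ->
  \sum_(b | reduced (rcons s b)) F s = (if s is [::] then q + 1 else q) * F s.
Proof.
move=> rs; rewrite sumr_const card_next // -mulr_natl.
by case: (s) => [|c t] //; rewrite natr2k.
Qed.

Lemma size_words_le l : (size (words l))%:R <= (q + 1) * q ^+ l.
Proof.
have q3 := growth_ge3.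
have -> : (size (words l))%:R = \sum_(s <- words l) (1 : R).
  by rewrite big_const_seq count_predT iter_addr_0.
case: l => [|l]; first by rewrite /= big_seq1 expr0 mulr1; lra.
apply: le_trans (@sum_words_le (fun=> 1) (fun t => if t == 0%N then q + 1 else q) _ _ _) _.
- by move=> t; case: ifP => _; lra.
- move=> s _ rs; rewrite (sum_next (fun=> 1) rs).
  by case: (s).
rewrite mulr1 big_ord_recl /= big_const_ord iter_mulr_1.
apply: ler_wpM2l; first by lra.
by rewrite exprS ler_peMl ?exprn_ge0 //; lra.
Qed.

Lemma size_words_ge l : q ^+ l <= (size (words l))%:R.
Proof.
have q3 := growth_ge3.
elim: l => [|l IHl]; first by rewrite expr0.
have E m : (size (words m))%:R = \sum_(s <- words m) (1 : R).
  by rewrite big_const_seq count_predT iter_addr_0.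
rewrite E sum_words_step exprS; apply: le_trans (ler_wpM2l _ IHl) _; first by lra.
rewrite E mulr_sumr big_seq [X in _ <= X]big_seq; apply: ler_sum => s.
rewrite mem_words => /andP[rs _]; rewrite (sum_next (fun=> 1) rs) mulr1.
by case: (s) => [|? ?]; lra.
Qed.

(** The indicator of the words obeying the restriction is a weight to which
    [sum_words_le] applies, with a factor [q - 1] in place of [q] for each
    position of the block. *)
Lemma constrained_count l x m (Q : nat -> seq (letter k) -> letter k -> bool)
    (E : pred (seq (letter k))) : (x + m <= l)%N ->
  (forall s, reduced s -> s != [::] ->
     (#|[pred b | reduced (rcons s b) && Q (size s) s b]| <= 2 * k - 2)%N) ->
  (forall s t b r, E s -> s = rcons t b ++ r -> (x <= size t < x + m)%N ->
     Q (size t) t b) ->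
  (count E (words l))%:R <= (q + 1) * q ^+ l * ((q - 1) / q) ^+ m.
Proof.
move=> le_l HQ HE; have q3 := growth_ge3.
pose b0 : letter k := (Ordinal (ltnW k_gt1), true).
pose block (t : nat) := (x <= t < x + m)%N.
pose ok s := all (fun i => block i ==> Q i (take i s) (nth b0 s i)) (iota 0 (size s)).
have ok_rcons s b : ok (rcons s b) = ok s && (block (size s) ==> Q (size s) s b).
  rewrite /ok size_rcons -addn1 iotaD add0n all_cat /= andbT; congr (_ && _).
    apply: eq_in_all => i; rewrite mem_iota add0n => /andP[_ lti].
    by rewrite nth_rcons lti -cats1 takel_cat // ltnW.
  by rewrite nth_rcons ltnn eqxx -cats1 takel_cat ?take_size.
pose F s : R := (ok s)%:R.
pose lam (t : nat) : R := (if t == 0%N then q + 1 else 1) * (if block t then q - 1 else q).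
have le_count : (count E (words l))%:R <= \sum_(s <- words l) F s.
  rewrite -sum1_count natr_sum [X in X <= _]big_mkcond; apply: ler_sum => s _.
  rewrite /F; case: ifP => // Es; rewrite ler_nat lt0b.
  apply/allP => i; rewrite mem_iota add0n => /andP[_ lti]; apply/implyP => bi.
  have := HE s (take i s) (nth b0 s i) (drop i.+1 s) Es _ _.
  rewrite size_takel; last exact: ltnW.
  apply=> //; rewrite cat_rcons -drop_nth // cat_take_drop //.
apply: le_trans le_count _.
apply: le_trans (@sum_words_le F lam l _ _) _.
- by move=> t; rewrite /lam; case: ifP => _; case: ifP => _; rewrite mulr_ge0 //; lra.
- move=> s lts rs; rewrite /F.
  have [oks|noks] := boolP (ok s); last first.
    by rewrite mulr0 big1 // => b _; rewrite ok_rcons (negbTE noks).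
  rewrite mulr1.
  have -> : \sum_(b | reduced (rcons s b)) (ok (rcons s b))%:R =
     (#|[pred b | reduced (rcons s b) && (block (size s) ==> Q (size s) s b)]|)%:R :> R.
    transitivity (\sum_(b | reduced (rcons s b) && (block (size s) ==> Q (size s) s b)) 1 : R).
      rewrite [RHS]big_mkcondr; apply: eq_bigr => b _.
      by rewrite ok_rcons oks andTb; case: (_ ==> _).
    by rewrite -sum1_card natr_sum; apply: eq_bigl.
  have le_next : (#|[pred b | reduced (rcons s b) && (block (size s) ==> Q (size s) s b)]|)%:R
      <= (if s is [::] then q + 1 else q).
    apply: le_trans (_ : (#|[pred b | reduced (rcons s b)]|)%:R <= _).
      by rewrite ler_nat; apply: subset_leq_card; apply/fintype.subsetP => b /andP[].
    by rewrite card_next //; case: (s); rewrite ?natr2k.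
  rewrite /lam; case bs : (block (size s)) in le_next *; last first.
    by apply: le_trans le_next _; case: (s) => [|? ?]; rewrite /= ?mul1r; nra.
  have [s0|s0] := eqVneq s [::].
    by apply: le_trans le_next _; rewrite s0 /=; nra.
  rewrite size_eq0 (negbTE s0) mul1r (_ : q - 1 = (2 * k - 2)%:R).
    by rewrite ler_nat; exact: HQ.
  by apply/eqP; rewrite subr_eq natr1; apply/eqP; rewrite /growth; congr (_%:R); lia.
have -> : F [::] = 1 by [].
rewrite mulr1 big_split /=.
have q0 : q != 0 by apply/eqP; lra.
set rho := (q - 1) / q; have rhoE : q * rho = q - 1 by rewrite mulrC mulfVK.
have -> : \prod_(t < l) (if block t then q - 1 else q) = q ^+ l * rho ^+ m.
  have -> : m = minn m (l - x) by lia.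
  elim: (l) => [|l' IHl']; first by rewrite big_ord0 sub0n minn0 mulr1.
  rewrite big_ord_recr /= IHl'; case: ifP => bl.
    have -> : minn m (l'.+1 - x) = (minn m (l' - x)).+1 by move: bl; rewrite /block; lia.
    by rewrite -rhoE !exprS; lra.
  have -> : minn m (l'.+1 - x) = minn m (l' - x) by move: bl; rewrite /block; lia.
  by rewrite exprS; lra.
rewrite -mulrA; apply: ler_wpM2r.
  by rewrite mulr_ge0 ?exprn_ge0 ?divr_ge0 //; lra.
case: (l) => [|l']; first by rewrite big_ord0; lra.
by rewrite big_ord_recl /= big1 ?mulr1.
Qed.

End Weights.
End Words.

(** * Large deviations of the number of turns *)

(** A lower bound for [ln (1 + y)], obtained by inverting [1 + x <= expR x] at
    [x = - (y - 2 * y ^+ 2)]. *)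
Lemma expR_le1D (R : realType) (y : R) : - (1 / 2) <= y -> expR (y - 2 * y ^+ 2) <= 1 + y.
Proof.
move=> y_ge; have h := expR_ge1Dx (- (y - 2 * y ^+ 2)).
have e_gt0 := expR_gt0 (y - 2 * y ^+ 2).
have y2 : 0 <= y ^+ 2 by exact: sqr_ge0.
rewrite expRN in h.
have h2 : (1 + - (y - 2 * y ^+ 2)) * expR (y - 2 * y ^+ 2) <= 1.
  by rewrite -ler_pdivlMr // div1r.
have h3 : 1 <= (1 + y) * (1 + - (y - 2 * y ^+ 2)).
  have -> : (1 + y) * (1 + - (y - 2 * y ^+ 2)) = 1 + y ^+ 2 * (1 + 2 * y) by lra.
  by rewrite lerDl mulr_ge0 //; lra.
have y1 : 0 <= 1 + y by lra.
have := ler_wpM2l y1 h2; rewrite mulr1 mulrA; apply: le_trans.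
by rewrite ler_peMl // ltW.
Qed.

Section Deviation.
Variables (R : realType) (k : nat).
Hypothesis k_gt1 : (1 < k)%N.
Implicit Types (a b c d : letter k) (s t : seq (letter k)).

Notation q := (growth k R).
Let q3 : 3 <= q. Proof. exact: growth_ge3. Qed.

Definition turn_freq : R := ((q + 1) * q)^-1.

Let u : R := (q ^+ 2 - 1)^-1.

Let uE : u * (q ^+ 2 - 1) = 1.
Proof. by rewrite mulVf //; apply/eqP; have := q3; nra. Qed.

Let u_gt0 : 0 < u. Proof. by rewrite invr_gt0; have := q3; nra. Qed.

Let freqE : turn_freq * q = u * (q - 1).
Proof.
have q0 : q != 0 by apply/eqP; have := q3; lra.
have q1 : q + 1 != 0 by apply/eqP; have := q3; lra.
have qm1 : q - 1 != 0 by apply/eqP; have := q3; lra.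
rewrite /turn_freq invfM mulfVK // /u.
by rewrite (_ : q ^+ 2 - 1 = (q + 1) * (q - 1)) ?invfM ?mulfVK //; lra.
Qed.

(** A solution of the Poisson equation for the count of the turn [(a, b)] along
    the chain of the letters of a random word: with the corrections by
    [potential], the increments of the count have mean zero at every step. *)
Definition potential a c : R :=
  if c == a then u * q else if c == linv a then - u else 0.

Definition increment a b (p : letter k * letter k) : R :=
  (p == (a, b))%:R - turn_freq + potential a p.2 - potential a p.1.

Lemma sum_potential a : \sum_d potential a d = u * (q - 1).
Proof.
rewrite (bigD1 a) //= (bigD1 (linv a)) ?linv_neq //= big1; last first.
  by move=> d /andP[/negbTE h1 /negbTE h2]; rewrite /potential h1 h2.
by rewrite /potential !eqxx (negbTE (linv_neq a)); lra.
Qed.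

Lemma sum_increment a b c : b != linv a -> \sum_(d | d != linv c) increment a b (c, d) = 0.
Proof.
move=> ab; rewrite !big_split /= !sumrN.
have sum_const (x : R) : \sum_(d | d != linv c) x = q * x.
  rewrite sumr_const -mulr_natl /growth; congr (_%:R * _).
  by rewrite subn1 -card_letter -(cardC1 (linv c)); apply: eq_card.
have -> : \sum_(d | d != linv c) ((c, d) == (a, b))%:R = (c == a)%:R :> R.
  have [->|nc] := eqVneq c a; last first.
    by rewrite big1 // => d _; rewrite xpair_eqE (negbTE nc).
  rewrite (bigD1 b) //= big1 ?eqxx ?addr0 // => d /andP[_ /negbTE db].
  by rewrite xpair_eqE db andbF.
have -> : \sum_(d | d != linv c) potential a d = u * (q - 1) - potential a (linv c).
  by rewrite -(sum_potential a) [in RHS](bigD1 (linv c)) //= [RHS]addrC addKr.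
rewrite !sum_const [q * turn_freq]mulrC freqE /potential.
have h := uE; have [->|nca] := eqVneq c a.
  by rewrite (negbTE (linv_neq a)) !eqxx /=; lra.
have [->|nla] := eqVneq c (linv a); first by rewrite linvK !eqxx mulr0n; lra.
rewrite (inj_eq (@linv_inj k)) (negbTE nca) mulr0n ifF; first by lra.
by apply: contraNF nla => /eqP <-; rewrite linvK.
Qed.

Lemma potential_bound a c : - (1 / 2) <= potential a c <= 1 / 2.
Proof.
have h1 := u_gt0; have h2 := uE; have h3 := q3.
have uq : u * q <= 1 / 2.
  have : u * q * 2 <= 1 by rewrite -uE -mulrA ler_pM2l //; nra.
  by lra.
have ule : u <= u * q by rewrite ler_peMr; lra.
by rewrite /potential; case: ifP => _; [|case: ifP => _]; lra.
Qed.

Lemma turn_freq_bound : 0 < turn_freq <= 1.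
Proof.
have h3 := q3; rewrite invr_gt0 mulr_gt0 ?invf_le1 /=; try lra.
  nra.
by rewrite mulr_gt0; lra.
Qed.

Lemma increment_bound a b p : `|increment a b p| <= 2.
Proof.
have := potential_bound a p.1; have := potential_bound a p.2; have := turn_freq_bound.
rewrite ler_norml /increment.
by case: (p == _) => /= /andP[? ?] /andP[? ?] /andP[? ?]; lra.
Qed.

Lemma sum_turn_increment a b c s :
  \sum_(p <- turns (c :: s)) increment a b p =
  (count_mem (a, b) (turns (c :: s)))%:R - turn_freq * (size s)%:R
    + potential a (last c s) - potential a c.
Proof.
elim: s c => [|d s IHs] c; first by rewrite big_nil /=; lra.
rewrite turns_cons2 big_cons IHs /= natrD [(size s).+1%:R]mulrSr /increment /=.
by lra.
Qed.

(** The product of the factors [1 - th * increment] along a word is a martingale,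
    hence has mean 1. It is exponentially large on words with too few turns
    [(a, b)], since it is there at least the exponential of
    [th * delta * l - 8 * th ^+ 2 * l] up to a constant; [th = delta / 16] makes
    the second term half of the first. *)
Lemma turn_deviation (rho : R) : 0 <= rho < turn_freq ->
  exists C kappa : R, [/\ 0 < C, 1 < kappa & forall l a b, b != linv a ->
    (count [pred s | (count_mem (a, b) (turns s))%:R <= rho * l%:R] (words k l))%:R
      <= C * q ^+ l * kappa ^- l].
Proof.
move=> /andP[rho_ge0 rho_lt]; have /andP[tf_gt0 tf_le1] := turn_freq_bound.
have h3 := q3.
pose delta := turn_freq - rho; pose th := delta / 16.
have d_gt0 : 0 < delta by rewrite /delta; lra.
have th_bound : 0 < th <= 1 / 16 by rewrite /th /delta; lra.
have /andP[th_gt0 th_le] := th_bound.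
pose kappa := expR (delta ^+ 2 / 32).
have kappa_gt1 : 1 < kappa by rewrite expR_gt1 divr_gt0 ?exprn_gt0.
exists ((q + 1) * expR (2 * th)), kappa; split => //.
  by rewrite mulr_gt0 ?expR_gt0 //; lra.
move=> l a b ab; set E := [pred s | _].
pose F s : R := \prod_(p <- turns s) (1 - th * increment a b p).
have Flow s : expR (- th * (\sum_(p <- turns s) increment a b p)
    - 8 * th ^+ 2 * (size (turns s))%:R) <= F s.
  rewrite /F; elim: (turns s) => [|p r IHr].
    by rewrite !big_nil /= !mulr0 subr0 expR0.
  rewrite !big_cons; set S := \sum_(_ <- _) _ in IHr *.
  have := increment_bound a b p; rewrite ler_norml => /andP[x1 x2].
  set x := increment a b p in x1 x2 *.
  apply: le_trans (_ : expR (- th * x - 8 * th ^+ 2) *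
       expR (- th * S - 8 * th ^+ 2 * (size r)%:R) <= _).
    by rewrite -expRD ler_expR /= [(size r).+1%:R]mulrSr; lra.
  apply: ler_pM => //; try exact: expR_ge0.
  have y1 : - (1 / 2) <= - (th * x).
    have : th * x <= th * 2 by rewrite ler_pM2l.
    by lra.
  apply: le_trans (expR_le1D y1); rewrite ler_expR.
  have h : x ^+ 2 <= 4.
    have : 0 <= (2 - x) * (x + 2) by rewrite mulr_ge0; lra.
    by lra.
  by have := ler_wpM2l (sqr_ge0 th) h; rewrite sqrrN -[th ^+ 2 * x ^+ 2]exprMn; lra.
have Fge0 s : 0 <= F s by apply: le_trans (Flow s); exact: expR_ge0.
have Fsum : \sum_(s <- words k l) F s <= (q + 1) * q ^+ l.
  apply: le_trans (@sum_words_le _ R F (fun t : nat => if t == 0%N then q + 1 else q) _ _ _) _.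
  - by move=> t; case: ifP => _; lra.
  - move=> s _ rs; case/lastP: s rs => [|s c] rs.
      have e d : F (rcons [::] d) = F [::] by rewrite /F !big_nil.
      rewrite (eq_bigr (fun=> F [::])) => [|d _]; last exact: e.
      by rewrite (sum_next k_gt1 F rs).
    have e d : F (rcons (rcons s c) d) = F (rcons s c) * (1 - th * increment a b (c, d)).
      by rewrite /F turns_rcons2 big_rcons mulrC.
    rewrite size_rcons /= (eq_bigl (fun d => d != linv c)) => [|d]; last first.
      by rewrite reduced_rcons rs.
    rewrite (eq_bigr (fun d => F (rcons s c) * (1 - th * increment a b (c, d)))) //.
    rewrite -mulr_sumr big_split /= sumrN -mulr_sumr sum_increment // mulr0 subr0.
    rewrite sumr_const mulrC (_ : #|_| = (2 * k - 1)%N) //.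
    by rewrite subn1 -card_letter -(cardC1 (linv c)); apply: eq_card.
  rewrite /F big_nil mulr1.
  case: l {E} => [|l]; first by rewrite big_ord0 expr0; lra.
  rewrite big_ord_recl /= big_const_ord iter_mulr_1 exprS.
  apply: ler_wpM2l; first by lra.
  by rewrite ler_peMl ?exprn_ge0 //; lra.
have Elow s : s \in words k l -> E s -> expR (- (2 * th)) * kappa ^+ l <= F s.
  rewrite mem_words => /andP[_ /eqP sl] /= Es; apply: le_trans (Flow s).
  rewrite -expRM_natl -expRD ler_expR.
  case: s sl Es => [|c s] sl Es.
    by rewrite -sl /= big_nil mulr0; lra.
  rewrite sum_turn_increment size_turns /= in Es *.
  have p1 := potential_bound a c; have p2 := potential_bound a (last c s).
  move: Es; rewrite -sl /= [(size s).+1%:R]mulrSr.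
  set T := (count _ _)%:R; set z := (size s)%:R.
  have z_ge0 : 0 <= z :> R by rewrite ler0n.
  move: p1 p2 => /andP[_ p1] /andP[p2 _] Es.
  have p1' := potential_bound a c; move: p1' => /andP[p1' _].
  have p2' := potential_bound a (last c s); move: p2' => /andP[_ p2'].
  have S_le : T - turn_freq * z + potential a (last c s) - potential a c
     <= - delta * (z + 1) + 2 by rewrite /delta; lra.
  have := ler_wpM2l (ltW th_gt0) S_le.
  have -> : delta = 16 * th by rewrite /th; lra.
  by have := sqr_ge0 th; nra.
have ek : 0 < expR (- (2 * th)) * kappa ^+ l.
  by rewrite mulr_gt0 ?expR_gt0 // exprn_gt0 // (lt_trans ltr01).
have key : (count E (words k l))%:R * (expR (- (2 * th)) * kappa ^+ l) <= (q + 1) * q ^+ l.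
  apply: le_trans Fsum; rewrite -sum1_count natr_sum mulr_suml big_mkcond /=.
  rewrite big_seq [X in _ <= X]big_seq; apply: ler_sum => s sW.
  by case: ifP => [Es|_]; [rewrite mul1r Elow|exact: Fge0].
rewrite -(ler_pM2r ek); apply: le_trans key _.
rewrite le_eqVlt; apply/orP; left; apply/eqP.
have k0 : kappa ^+ l != 0 by rewrite expf_neq0 // lt0r_neq0 // (lt_trans ltr01).
rewrite expRN; have e0 := lt0r_neq0 (expR_gt0 (2 * th)).
transitivity ((q + 1) * q ^+ l * ((expR (2 * th) / expR (2 * th)) * (kappa ^+ l / kappa ^+ l))).
  by rewrite !divff // !mulr1.
by move: (expR _) (expR _)^-1 (kappa ^+ l) (kappa ^- l) (q ^+ l) => e1 e2 e3 e4 e5; lra.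
Qed.

End Deviation.

(** * Uniform choices in the ball *)

Section Ball.
Variables (R : realType) (k : nat).
Hypothesis k_gt1 : (1 < k)%N.
Notation q := (growth k R).

Lemma card_ball_ge n : q ^+ n <= #|{: wball k n}|%:R.
Proof.
apply: le_trans (size_words_ge R k_gt1 n) _; rewrite ler_nat cardE.
rewrite -(size_map (fun x : wball k n => x : seq (letter k))).
apply: uniq_leq_size (uniq_words _ _) _ => s; rewrite mem_words => /andP[rs /eqP ss].
have le_s : (size s <= n)%N by rewrite ss.
by apply/mapP; exists (@WBall k n (Bseq le_s) rs); rewrite ?mem_enum.
Qed.

Lemma card_ball_gt0 n : (0 < #|{: wball k n}|)%N.
Proof.
rewrite -(ltr_nat R); apply: lt_le_trans (card_ball_ge n).
by rewrite exprn_gt0 //; have := growth_ge3 R k_gt1; lra.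
Qed.

Lemma card_ball_count n (E : pred (seq (letter k))) :
  (#|[set x : wball k n | E x]%SET| <= \sum_(l < n.+1) count E (words k l))%N.
Proof.
rewrite cardE -(size_map (fun x : wball k n => x : seq (letter k))).
have -> : (\sum_(l < n.+1) count E (words k l))%N =
   size (seq.filter E (flatten [seq words k l | l <- iota 0 n.+1])).
  rewrite size_filter count_flatten sumnE !big_map -(big_mkord xpredT (fun l => count E (words k l))).
  by rewrite /index_iota subn0.
apply: uniq_leq_size.
  rewrite map_inj_uniq ?enum_uniq // => x y e.
  by do 2!apply: val_inj.
move=> _ /mapP[x + ->]; rewrite mem_enum finset.inE mem_filter => Ex; rewrite Ex andTb.
apply/flatten_mapP; exists (size x); last by rewrite mem_words eqxx (valP x).
by rewrite mem_iota /= add0n ltnS size_bseq.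
Qed.

Lemma ball_count_le n (E : pred (seq (letter k))) (c : R) : 0 <= c ->
  (forall l, (l <= n)%N -> (count E (words k l))%:R <= c * q ^+ n) ->
  #|[set x : wball k n | E x]%SET|%:R <= n.+1%:R * c * #|{: wball k n}|%:R.
Proof.
move=> c_ge0 HE.
apply: le_trans (_ : (\sum_(l < n.+1) count E (words k l))%:R <= _).
  by rewrite ler_nat card_ball_count.
rewrite natr_sum; apply: le_trans (_ : \sum_(l < n.+1) c * q ^+ n <= _).
  by apply: ler_sum => l _; apply: HE; rewrite -ltnS.
rewrite sumr_const card_ord -[_ *+ n.+1 in X in X <= _]mulr_natl -mulrA; apply: ler_wpM2l; first exact: ler0n.
by apply: ler_wpM2l => //; exact: card_ball_ge.
Qed.

End Ball.

Section Resample.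
Variables (R : realType) (I T : finType).
Implicit Types (w : {ffun I -> T}).

Definition update w j x : {ffun I -> T} := [ffun i => if i == j then x else w i].

(** Replacing the [j]-th coordinate of a uniform family by an independent choice
    gives a uniform family again. *)
Lemma card_resample j (E : pred {ffun I -> T}) (c : R) : (0 < #|T|)%N ->
  (forall w, #|[set x | E (update w j x)]%SET|%:R <= c * #|T|%:R) ->
  #|[set w | E w]%SET|%:R <= c * #|{ffun I -> T}|%:R.
Proof.
move=> T_gt0 HE; have T_gt0' : 0 < #|T|%:R :> R by rewrite ltr0n.
(* Exchanging the [j]-th coordinate of the family with an extra element. *)
pose h (wx : {ffun I -> T} * T) := (update wx.1 j wx.2, wx.1 j).
have hK : involutive h.
  move=> [w x]; rewrite /h /= ffunE eqxx; congr (_, _).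
  by apply/ffunP => i; rewrite !ffunE; case: eqP => [->|].
have swap : \sum_w \sum_x (E (update w j x))%:R = \sum_w \sum_(x : T) (E w)%:R :> R.
  rewrite !pair_bigA /= (reindex_inj (inv_inj hK)) /=.
  apply: eq_bigr => -[w x] _ /=; congr (nat_of_bool (E _))%:R.
  by apply/ffunP => i; rewrite !ffunE; case: eqP => [->|].
have countE (U : finType) (P : pred U) : \sum_x (P x)%:R = #|[set x | P x]%SET|%:R :> R.
  rewrite -sum1_card natr_sum [RHS]big_mkcond; apply: eq_bigr => x _.
  by rewrite finset.inE; case: (P x).
rewrite -(ler_pM2r T_gt0').
have <- : \sum_w \sum_(x : T) (E w)%:R = #|[set w | E w]%SET|%:R * #|T|%:R :> R.
  rewrite -countE mulr_suml; apply: eq_bigr => w _.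
  by rewrite sumr_const -[LHS]mulr_natr.
rewrite -swap; apply: le_trans (_ : \sum_(w : {ffun I -> T}) c * #|T|%:R <= _).
  by apply: ler_sum => w _; rewrite countE.
by rewrite sumr_const -[X in X <= _]mulr_natr mulrAC.
Qed.

End Resample.

Lemma card_union_le (U I : finType) (E : I -> pred U) :
  (#|[set w | [exists i, E i w]]%SET| <= \sum_i #|[set w | E i w]%SET|)%N.
Proof.
have -> : [set w | [exists i, E i w]]%SET = \bigcup_i [set w | E i w]%SET.
  apply/setP => w; rewrite finset.inE; apply/existsP/finset.bigcupP => [[i Ei]|[i _]].
    by exists i; rewrite ?finset.inE.
  by rewrite finset.inE => Ei; exists i.
elim/big_rec2: _ => [|i s A _ le_A]; first by rewrite cards0.
by apply: leq_trans (leq_card_setU _ _) _; rewrite leq_add2l.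
Qed.

(** * Exponential decay *)

Section Decay.
Variable R : realType.
Implicit Types (a b : nat -> R).

Definition decay a := exists C x : R, [/\ 0 < C, 0 < x < 1 & forall n, a n <= C * x ^+ n].

Lemma decay_add a b : decay a -> decay b -> decay (fun n => a n + b n).
Proof.
move=> [C [x [C0 /andP[x0 x1] H]]] [C' [x' [C'0 /andP[x'0 x'1] H']]].
exists (C + C'), (Num.max x x'); split; first exact: addr_gt0.
  by rewrite lt_max x0 gt_max x1 x'1.
have m0 : 0 <= Num.max x x' by rewrite le_max (ltW x0).
move=> n; rewrite mulrDl; apply: lerD.
  apply: le_trans (H n) _; rewrite ler_pM2l // lerXn2r ?nnegrE ?(ltW x0) //.
  by rewrite le_max lexx.
apply: le_trans (H' n) _; rewrite ler_pM2l // lerXn2r ?nnegrE ?(ltW x'0) //.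
by rewrite le_max lexx orbT.
Qed.

Lemma decay_scale c a : 0 <= c -> decay a -> decay (fun n => c * a n).
Proof.
move=> c0 [C [x [C0 x01 H]]]; exists (c * C + 1), x; split => //.
  by rewrite ltr_wpDl // mulr_ge0 // ltW.
move=> n; rewrite mulrDl -mulrA mul1r; apply: le_trans (ler_wpM2l c0 (H n)) _.
by rewrite lerDl exprn_ge0 // ltW; case/andP: x01.
Qed.

Lemma bernoulli (h : R) n : -1 <= h -> 1 + n%:R * h <= (1 + h) ^+ n.
Proof.
move=> h_ge; elim: n => [|n IHn]; first by rewrite mul0r addr0 expr0.
have h1 : 0 <= 1 + h by lra.
rewrite exprS; apply: le_trans (ler_wpM2l h1 IHn).
have : 0 <= n%:R * h ^+ 2 by rewrite mulr_ge0 ?sqr_ge0.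
by rewrite mulrSr; lra.
Qed.

(** A linear factor is absorbed by moving the rate [x] half-way to 1. *)
Lemma decay_poly a : decay a -> decay (fun n => n.+1%:R * a n).
Proof.
move=> [C [x [C0 /andP[x0 x1] H]]].
pose y := (1 + x) / 2; pose h := y / x - 1.
have xy : x < y by rewrite /y; lra.
have y0 : 0 < y by lra.
have h0 : 0 < h by rewrite /h subr_gt0 ltr_pdivlMr // mul1r.
exists ((1 + h^-1) * C), y; split.
- by rewrite mulr_gt0 // addr_gt0 // invr_gt0.
- by rewrite y0 /y; lra.
move=> n; have h1 : -1 <= h by lra.
have e : y = x * (1 + h) by rewrite /h addrC subrK mulrC mulfVK // lt0r_neq0.
have key : n.+1%:R <= (1 + h^-1) * (1 + h) ^+ n.
  apply: le_trans (_ : (1 + h^-1) * (1 + n%:R * h) <= _); last first.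
    by apply: ler_wpM2l (bernoulli n h1); rewrite addr_ge0 // invr_ge0 ltW.
  have hh : h^-1 * h = 1 by rewrite mulVf // lt0r_neq0.
  have : 0 <= h^-1 by rewrite invr_ge0 ltW.
  have : 0 <= n%:R * h by rewrite mulr_ge0 // ltW.
  have -> : (1 + h^-1) * (1 + n%:R * h) = 1 + n%:R * h + h^-1 + n%:R * (h^-1 * h) by lra.
  by rewrite hh mulrSr; lra.
rewrite e exprMn; apply: le_trans (ler_wpM2l _ (H n)) _; first exact: ler0n.
have xn : 0 <= C * x ^+ n by rewrite mulr_ge0 ?exprn_ge0 // ltW.
have := ler_wpM2r xn key; lra.
Qed.

(** By Bernoulli's inequality, [1 - e] is at least the [D]-th root of [r]. *)
Lemma decay_pow (r : R) D : (0 < D)%N -> 0 < r < 1 -> decay (fun n => r ^+ (n %/ D)).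
Proof.
move=> D0 /andP[r0 r1]; have D0' : 0 < D%:R :> R by rewrite ltr0n.
have D1 : 1 <= D%:R :> R by rewrite ler1n.
pose e := (1 - r) / D%:R.
have eD : D%:R * e = 1 - r by rewrite mulrC mulfVK // lt0r_neq0.
have e0 : 0 < e by rewrite divr_gt0 //; lra.
have e1 : e < 1 by rewrite ltr_pdivrMr // mul1r; lra.
have rD : r <= (1 - e) ^+ D.
  by apply: le_trans (@bernoulli (- e) D _); [rewrite mulrN eD|]; lra.
exists r^-1, (1 - e); split; first by rewrite invr_gt0.
  by apply/andP; split; lra.
move=> n; rewrite -ler_pdivrMl ?invr_gt0 // invrK -exprS.
apply: le_trans (_ : ((1 - e) ^+ D) ^+ (n %/ D).+1 <= _).
  by rewrite lerXn2r ?nnegrE ?exprn_ge0 //; lra.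
rewrite -exprM; apply: ler_wiXn2l; [lra|lra|].
by rewrite mulnC; apply: ltnW; apply: ltn_ceil.
Qed.

End Decay.

(** * Random words generate a generic family *)

Section Events.
Variables (R : realType) (k p n : nat).
Hypothesis k_gt1 : (1 < k)%N.
Notation q := (growth k R).
Implicit Types (a b c : letter k) (i j : 'I_p) (W : 'I_p -> seq (letter k)).

Let q3 : 3 <= q. Proof. exact: growth_ge3. Qed.

(** All words but the [j]-th one are fixed, and the ball is cut into spheres. *)
Lemma card_event j (E : ('I_p -> seq (letter k)) -> bool) (d : R) : 0 <= d ->
  (forall W l, (l <= n)%N ->
    (count (fun s => E (fun i => if i == j then s else W i)) (words k l))%:R <= d * q ^+ n) ->
  #|[set w : sample k p n | E (fun i => w i)]%SET|%:R <= n.+1%:R * d * #|sample k p n|%:R.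
Proof.
move=> d_ge0 HE; apply: (@card_resample R 'I_p (wball k n) j).
  exact: (@card_ball_gt0 R k k_gt1 n).
move=> w; apply: le_trans (ball_count_le k_gt1 d_ge0 (HE (fun i => w i))).
rewrite ler_nat; apply: subset_leq_card; apply/fintype.subsetP => x.
rewrite !finset.inE; congr (is_true (E _)); apply/funext => i.
by rewrite ffunE; case: ifP.
Qed.

Let rho : R := (q - 1) / q.

Let rho_ge0 : 0 <= rho.
Proof. by rewrite divr_ge0 //; have := q3; lra. Qed.

Lemma constrained_event j z m (E : ('I_p -> seq (letter k)) -> bool) Q :
  (forall W s, reduced s -> s != [::] ->
     (#|[pred b | reduced (rcons s b) && Q W (size s) s b]| <= 2 * k - 2)%N) ->
  (forall W, E W -> (z + m <= size (W j))%N) ->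
  (forall W t b r, E (fun i => if i == j then rcons t b ++ r else W i) ->
     (z <= size t < z + m)%N -> Q W (size t) t b) ->
  #|[set w : sample k p n | E (fun i => w i)]%SET|%:R
    <= n.+1%:R * ((q + 1) * rho ^+ m) * #|sample k p n|%:R.
Proof.
move=> HQ Hsize HE; have h3 := q3; apply: (@card_event j).
  by rewrite mulr_ge0 ?exprn_ge0 ?rho_ge0 //; lra.
move=> W l le_l; have [le_zm|lt_l] := leqP (z + m) l.
  apply: le_trans (_ : (q + 1) * q ^+ l * rho ^+ m <= _).
    by apply: (@constrained_count k R k_gt1 l z m (Q W) _ le_zm (HQ W)) => s t b r Es e; rewrite e in Es; exact: HE Es.
  rewrite -[X in _ <= X]mulrAC; apply: ler_wpM2r; first by rewrite exprn_ge0 ?rho_ge0.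
  by apply: ler_wpM2l; [lra|apply: ler_weXn2l => //; lra].
rewrite (_ : count _ _ = 0%N); last first.
  apply/eqP; rewrite -leqn0 leqNgt -has_count; apply/hasPn => s.
  rewrite mem_words => /andP[_ /eqP ss]; apply/negP => /Hsize.
  by rewrite eqxx ss leqNgt lt_l.
by rewrite !mulr_ge0 ?exprn_ge0 ?rho_ge0 //; lra.
Qed.

Lemma copies_event m i j f e x y z :
  #|[set w : sample k p n | copies k_gt1 m (fun i => w i) i j f e x y z]%SET|%:R
    <= n.+1%:R * ((q + 1) * rho ^+ m) * #|sample k p n|%:R.
Proof.
set a0 : letter k := (Ordinal (ltnW k_gt1), true).
apply: (@constrained_event j z m (fun W => copies k_gt1 m W i j f e x y z)
  (fun W t s b => b == f (nth a0 (if i == j then s else W i) (mirror e x y t)))).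
- move=> W s _ _; set d := f _; apply: (@leq_trans #|pred1 d|).
    by apply: subset_leq_card; apply/fintype.subsetP => b /andP[].
  by rewrite card1; lia.
- by move=> W /andP[].
move=> W t b r /andP[_ /forallP /(_ (Ordinal (_ : (size t - z < m)%N)))].
move=> H /andP[le_z lt_z]; have lt_m : (size t - z < m)%N by lia.
move: (H lt_m) => /=; rewrite subnKC // eqxx cat_rcons => /andP[lt_s].
rewrite nth_cat ltnn subnn /= => /eqP ->; apply/eqP; congr f.
move: lt_s; case: (i == j) => //= lt_s.
by rewrite nth_cat lt_s.
Qed.

Lemma avoids_event m j c z :
  #|[set w : sample k p n | avoids k_gt1 m (fun i => w i) j c z]%SET|%:R
    <= n.+1%:R * ((q + 1) * rho ^+ m) * #|sample k p n|%:R.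
Proof.
apply: (@constrained_event j z m (fun W => avoids k_gt1 m W j c z)
  (fun W t s b => b \notin [:: c; linv c])).
- move=> W s _ _; apply: (@leq_trans #|(~: [set c; linv c])%SET|).
    apply: subset_leq_card; apply/fintype.subsetP => b /andP[_].
    by rewrite !finset.inE.
  have := cardsC [set c; linv c]%SET; rewrite cards2 eq_sym linv_neq card_letter.
  by move=> /= E; lia.
- by move=> W /andP[].
move=> W t b r /andP[_ /forallP /(_ (Ordinal (_ : (size t - z < m)%N)))].
move=> H /andP[le_z lt_z]; have lt_m : (size t - z < m)%N by lia.
by move: (H lt_m) => /=; rewrite subnKC // eqxx cat_rcons nth_cat ltnn subnn.
Qed.

Lemma short_event j :
  #|[set w : sample k p n | (2 * size (w j) < n)%N]%SET|%:R
    <= n.+1%:R * ((q + 1) * q^-1 ^+ (n %/ 2)) * #|sample k p n|%:R.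
Proof.
have h3 := q3.
have d_ge0 : 0 <= (q + 1) * q^-1 ^+ (n %/ 2).
  by rewrite mulr_ge0 ?exprn_ge0 ?invr_ge0 //; lra.
apply: (@card_event j (fun W => 2 * size (W j) < n)%N) => // W l le_l.
have [lt_l|ge_l] := ltnP (2 * l) n; last first.
  rewrite (_ : count _ _ = 0%N); last first.
    apply/eqP; rewrite -leqn0 leqNgt -has_count; apply/hasPn => s.
    by rewrite mem_words eqxx => /andP[_ /eqP ->]; rewrite -leqNgt.
  by rewrite mulr_ge0 // exprn_ge0 //; lra.
apply: le_trans (_ : (size (words k l))%:R <= _); first by rewrite ler_nat count_size.
apply: le_trans (size_words_le R k_gt1 l) _.
rewrite -mulrA; apply: ler_wpM2l; first by lra.
have -> : q ^+ n = q ^+ (n %/ 2) * q ^+ (n - n %/ 2) by rewrite -exprD subnKC //; lia.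
rewrite exprVn mulKf ?expf_neq0 //; last by apply/eqP; lra.
by apply: ler_weXn2l; [lra|lia].
Qed.

Lemma turns_event j a b (K L : nat) (rho' C kappa : R) : 0 < C -> 1 < kappa ->
  (forall l, (count [pred s | (count_mem (a, b) (turns s))%:R <= rho' * l%:R] (words k l))%:R
      <= C * q ^+ l * kappa ^- l) ->
  (forall l T, (n <= 2 * l)%N -> (K * T < 2 * l + K * (2 * L))%N -> T%:R <= rho' * l%:R) ->
  #|[set w : sample k p n | (n <= 2 * size (w j))%N &&
      (K * count_mem (a, b) (turns (w j)) < 2 * size (w j) + K * (2 * L))%N]%SET|%:R
    <= n.+1%:R * (C * kappa^-1 ^+ (n %/ 2)) * #|sample k p n|%:R.
Proof.
move=> C0 kappa1 Hd HT; have h3 := q3.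
have k0 : 0 < kappa by lra.
have d_ge0 : 0 <= C * kappa^-1 ^+ (n %/ 2).
  by rewrite mulr_ge0 ?exprn_ge0 ?invr_ge0 // ltW.
apply: (@card_event j (fun W => (n <= 2 * size (W j))%N &&
  (K * count_mem (a, b) (turns (W j)) < 2 * size (W j) + K * (2 * L))%N)) => // W l le_l.
have [le_n|lt_n] := leqP n (2 * l); last first.
  rewrite (_ : count _ _ = 0%N); last first.
    apply/eqP; rewrite -leqn0 leqNgt -has_count; apply/hasPn => s.
    by rewrite mem_words eqxx => /andP[_ /eqP ->]; rewrite leqNgt lt_n.
  by rewrite mulr_ge0 // exprn_ge0 //; lra.
apply: le_trans (_ : (count [pred s | (count_mem (a, b) (turns s))%:R <= rho' * l%:R]
   (words k l))%:R <= _).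
  rewrite ler_nat -!size_filter; apply: uniq_leq_size; first by rewrite filter_uniq ?uniq_words.
  move=> s; rewrite !mem_filter eqxx => /andP[/andP[_ lt_s] sW]; rewrite sW andbT /=.
  by move: sW; rewrite mem_words => /andP[_ /eqP ss]; apply: HT => //; rewrite -ss.
apply: le_trans (Hd l) _; rewrite mulrAC; apply: ler_pM.
- by rewrite mulr_ge0 ?(ltW C0) // invr_ge0 exprn_ge0 // ltW.
- by rewrite exprn_ge0 //; lra.
- apply: ler_wpM2l; first exact: ltW.
  rewrite -exprVn; apply: ler_wiXn2l; [by rewrite invr_ge0 ltW|by rewrite invf_le1 // ltW|lia].
by apply: ler_weXn2l; [lra|].
Qed.

End Events.

Section Assembly.
Variables (R : realType) (k p : nat).
Hypothesis k_gt1 : (1 < k)%N.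
Implicit Types (a b c : letter k) (i j : 'I_p).

Let K := (8 * k ^ 2 - 7)%N.
(** The block length will be [n %/ scale]; [turn_freq_margin] is the reason for
    this choice. *)
Let scale := (256 * k ^ 4)%N.

(** The left-hand side is the frequency of a turn required by [gen_turns], the
    second term accounting for blocks of length [n %/ scale] in a word of length
    at least half of [n]. *)
Lemma turn_freq_margin : 2 / K%:R + 4 / scale%:R < turn_freq R k.
Proof.
have k2 : 2 <= k%:R :> R by rewrite ler_nat.
have KE : K%:R = 8 * k%:R ^+ 2 - 7 :> R.
  apply/eqP; rewrite eq_sym subr_eq -natrX -natrM -natrD eqr_nat /K; apply/eqP.
  by move: k_gt1; clear; case: k => [|[|m]] // _; rewrite /expn /=; nia.
have SE : scale%:R = 256 * k%:R ^+ 4 :> R by rewrite /scale natrM natrX.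
have qE : growth k R = 2 * k%:R - 1.
  by apply/eqP; rewrite eq_sym subr_eq natr1 -natrM eqr_nat; apply/eqP; lia.
rewrite /turn_freq qE KE SE; set x := k%:R in k2 *.
have x0 : 0 < x by lra.
have K0 : 0 < 8 * x ^+ 2 - 7 by nra.
have x4 : 0 < x ^+ 4 by rewrite exprn_gt0.
have y0 : 0 < (2 * x - 1 + 1) * (2 * x - 1) by nra.
rewrite -[X in _ < X]mul1r ltr_pdivlMr // addf_div ?lt0r_neq0 ?mulr_gt0 //.
rewrite mulrAC ltr_pdivrMr ?mulr_gt0 // mul1r -subr_gt0.
have -> : (8 * x ^+ 2 - 7) * (256 * x ^+ 4) -
   (2 * (256 * x ^+ 4) + 4 * (8 * x ^+ 2 - 7)) * ((2 * x - 1 + 1) * (2 * x - 1))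
   = 4 * (x * (x ^+ 3 * (256 * x - 480) + 16 * x ^+ 2 + 28 * x - 14)) by lra.
rewrite !mulr_gt0 //.
have : 0 <= x ^+ 3 * (256 * x - 480) by rewrite mulr_ge0 ?exprn_ge0 //; lra.
have : 0 <= x ^+ 2 by rewrite sqr_ge0.
lra.
Qed.

Let K_gt0 : (0 < K)%N.
Proof. by rewrite /K; move: k_gt1; clear; case: k => [|[|m]] // _; rewrite /expn /=; nia. Qed.

Let scale_ge : (256 <= scale)%N.
Proof. by rewrite /scale leq_pmulr // expn_gt0; move: k_gt1; lia. Qed.

Lemma few_turns n l T : (n <= 2 * l)%N -> (K * T < 2 * l + K * (2 * (n %/ scale)))%N ->
  T%:R <= (2 / K%:R + 4 / scale%:R) * l%:R :> R.
Proof.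
move=> le_n lt_T; have K0 : 0 < K%:R :> R by rewrite ltr0n.
have s0 : 0 < scale%:R :> R by rewrite ltr0n; apply: leq_trans scale_ge.
have h1 : (n %/ scale)%:R <= 2 * l%:R / scale%:R :> R.
  rewrite ler_pdivlMr // -!natrM ler_nat; apply: leq_trans le_n; exact: leq_divM.
have h2 : K%:R * T%:R <= 2 * l%:R + K%:R * (2 * (n %/ scale)%:R) :> R.
  by rewrite -!natrM -natrD ler_nat; exact: ltnW.
rewrite -(ler_pM2l K0); apply: le_trans h2 _.
have -> : K%:R * ((2 / K%:R + 4 / scale%:R) * l%:R) =
    2 * l%:R * (K%:R / K%:R) + K%:R * (2 * (2 * l%:R / scale%:R)) :> R by lra.
rewrite divff ?lt0r_neq0 // mulr1 lerD2l.
by apply: ler_wpM2l; [exact: ltW|apply: ler_wpM2l].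
Qed.

Definition too_short n (w : sample k p n) := [exists j, (2 * size (w j) < n)%N].

Definition unbalanced n (w : sample k p n) :=
  [exists x : 'I_p * letter k * letter k, let: (j, a, b) := x in
    (b != linv a) && ((n <= 2 * size (w j))%N &&
      (K * count_mem (a, b) (turns (w j)) < 2 * size (w j) + K * (2 * (n %/ scale)))%N)].

Definition block_avoids n (w : sample k p n) :=
  [exists x : 'I_p * letter k * 'I_n.+1, let: (j, c, z) := x in
    avoids k_gt1 (n %/ scale)./2 (fun i => w i) j c z].

Definition block_copies n (w : sample k p n) :=
  [exists x : 'I_p * 'I_p * {ffun letter k -> letter k} * bool * 'I_n.+1 * 'I_n.+1 * 'I_n.+1,
    let: (i, j, f, e, x, y, z) := x in
    copies k_gt1 (n %/ scale)./2 (fun i => w i) i j f e x y z].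

Lemma generic_events n (w : sample k p n) : (scale <= n)%N ->
  ~~ too_short w -> ~~ unbalanced w -> ~~ block_avoids w -> ~~ block_copies w ->
  generic (fun i => wball_fg (w i)) (n %/ scale).
Proof.
move=> le_n /existsPn ns /existsPn nu /existsPn na /existsPn nc.
have long j : (n <= 2 * size (w j))%N by rewrite leqNgt.
have L_le : (scale * (n %/ scale) <= n)%N by rewrite mulnC leq_divM.
have sylE i e : size (syllable (fun i => wball_fg (w i)) (i, e)) = size (w i).
  by case: e; rewrite /syllable //= size_winv.
split.
- by rewrite divn_gt0 //; apply: leq_trans scale_ge.
- move=> [i e]; rewrite sylE; have := long i.
  by move: L_le scale_ge; move: (n %/ scale)%N => L; nia.
- have L_gt0 : (0 < n %/ scale)%N by rewrite divn_gt0 //; apply: leq_trans scale_ge.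
  apply: (@no_repeated_block k p k_gt1 (fun i => wball_fg (w i)) n (n %/ scale) L_gt0).
  + by move=> i; apply: size_bseq.
  + move=> i j f e x y z lex ley lez.
    have lt m : (m <= n)%N -> (m < n.+1)%N by [].
    have := nc (i, j, [ffun a => f a], e, Ordinal (lt _ lex), Ordinal (lt _ ley), Ordinal (lt _ lez)).
    by rewrite (_ : ([ffun a => f a] : letter k -> letter k) = f) //; apply/funext => a; rewrite ffunE.
  + move=> j c z lez; have lt m : (m <= n)%N -> (m < n.+1)%N by [].
    by have := na (j, c, Ordinal (lt _ lez)).
have H j a b : b != linv a ->
    (2 * size (w j) + K * (2 * (n %/ scale)) <= K * count_mem (a, b) (turns (w j)))%N.
  by move=> ab; have := nu (j, a, b); rewrite ab long /= -leqNgt.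
move=> [j e] a b ab; rewrite sylE -/K; case: e; first exact: H.
have -> : fg_word (syllable (fun i => wball_fg (w i)) (j, false)) = winv (w j) by [].
rewrite count_turns_winv; apply: H.
by rewrite linvK eq_sym.
Qed.

End Assembly.

Theorem theorem1p4 (R : realType) (k p : nat) (hk : (2 <= k)%N) (hp : (1 <= p)%N) :
  exponentially_generic R (fun n : nat =>
    [set w : sample k p n |
       Aut_malnormal (sample_subgroup w) /\
       Aut_stab (sample_subgroup w) = Inn (sample_subgroup w)]%classic).
Proof.
have h3 := growth_ge3 R hk; set Q := growth k R in h3; set scale := (256 * k ^ 4)%N.
have scale_gt0 : (0 < scale)%N by rewrite muln_gt0 expn_gt0 /=; lia.
have margin := turn_freq_margin R hk.
have rho_ge0 : 0 <= 2 / (8 * k ^ 2 - 7)%:R + 4 / scale%:R :> R.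
  by rewrite addr_ge0 // divr_ge0.
have [C [kappa [C0 kappa1 Hdev]]] : exists C kappa : R, [/\ 0 < C, 1 < kappa & _] :=
  turn_deviation hk (introT andP (conj rho_ge0 margin)).
pose N1 := #|{: 'I_p}|. pose N2 := #|{: 'I_p * letter k * letter k}|.
pose N3 := #|{: 'I_p * letter k}|.
pose N4 := #|{: 'I_p * 'I_p * {ffun letter k -> letter k} * bool}|.
pose cS n := (Q + 1) * Q^-1 ^+ (n %/ 2).
pose cT n := C * kappa^-1 ^+ (n %/ 2).
pose cB n := (Q + 1) * ((Q - 1) / Q) ^+ (n %/ (scale * 2)).
pose bound n := N1%:R * (n.+1%:R * cS n) + N2%:R * (n.+1%:R * cT n)
  + N3%:R * (n.+1%:R * (n.+1%:R * cB n))
  + N4%:R * (n.+1%:R * (n.+1%:R * (n.+1%:R * (n.+1%:R * cB n)))).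
have inv01 (x : R) : 1 < x -> 0 < x^-1 < 1.
  by move=> x1; rewrite invr_gt0 invf_lt1 ?x1 ?andbT // (lt_trans ltr01).
have decay_cS : decay cS.
  apply: decay_scale; first by lra.
  by apply: decay_pow => //; apply: inv01; lra.
have decay_cT : decay cT.
  by apply: decay_scale; [exact: ltW|apply: decay_pow => //; apply: inv01].
have decay_cB : decay cB.
  apply: decay_scale; first by lra.
  apply: decay_pow; first by rewrite muln_gt0 scale_gt0.
  have Q0 : 0 < Q by lra.
  by rewrite divr_gt0 ?ltr_pdivrMr //=; lra.
have decay_bound : decay bound.
  apply: decay_add; [apply: decay_add; [apply: decay_add|]|]; apply: decay_scale => //;
    by repeat apply: decay_poly.
have main n : (scale <= n)%N -> uniform_pr R (~` [set w : sample k p n |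
    Aut_malnormal (sample_subgroup w) /\
    Aut_stab (sample_subgroup w) = Inn (sample_subgroup w)]%classic) <= bound n.
  move=> le_n; rewrite /uniform_pr.
  have card_gt0 : 0 < #|sample k p n|%:R :> R.
    rewrite ltr0n card_ffun expn_gt0; apply/orP; left; exact: (card_ball_gt0 R hk).
  rewrite ler_pdivrMr //.
  pose Su := [set w : sample k p n | too_short w]%SET.
  pose Ub := [set w : sample k p n | unbalanced w]%SET.
  pose Av := [set w : sample k p n | block_avoids hk w]%SET.
  pose Co := [set w : sample k p n | block_copies hk w]%SET.
  apply: le_trans (_ : (#|Su| + #|Ub| + #|Av| + #|Co|)%:R <= _).
    rewrite ler_nat; apply: leq_trans (_ : #|Su :|: Ub :|: Av :|: Co| <= _)%N.
      apply: subset_leq_card; apply/fintype.subsetP => w; rewrite !finset.inE.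
      move=> /asboolP nH; apply: contrapT => /negP; rewrite !negb_or.
      move=> /andP[/andP[/andP[n1 n2] n3] n4]; apply: nH.
      exact: (generic_malnormal hk hp (generic_events le_n n1 n2 n3 n4)).
    do 2?[apply: leq_trans (leq_card_setU _ _) _; rewrite leq_add2r].
    exact: leq_card_setU.
  have sum_bound (I : finType) (E : I -> pred (sample k p n)) (d : R) :
      (forall i, #|[set w | E i w]%SET|%:R <= d * #|sample k p n|%:R) ->
      #|[set w | [exists i, E i w]]%SET|%:R <= #|I|%:R * d * #|sample k p n|%:R.
    move=> HE; apply: le_trans (_ : (\sum_i #|[set w | E i w]%SET|)%:R <= _).
      by rewrite ler_nat card_union_le.
    rewrite natr_sum; apply: le_trans (ler_sum _ (fun i _ => HE i)) _.
    by rewrite sumr_const -[_ *+ _]mulr_natl mulrA.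
  have mE : (n %/ (scale * 2) = (n %/ scale)./2)%N by rewrite divnMA divn2.
  rewrite !natrD /bound !mulrDl; apply: lerD; [apply: lerD; [apply: lerD|]|].
  - by apply: sum_bound => j; apply: short_event.
  - apply: (@sum_bound _ (fun x (w : sample k p n) => let: (j, a, b) := x in
      (b != linv a) && ((n <= 2 * size (w j))%N &&
      ((8 * k ^ 2 - 7) * count_mem (a, b) (turns (w j)) <
         2 * size (w j) + (8 * k ^ 2 - 7) * (2 * (n %/ scale)))%N))) => -[[j a] b].
    have [ab|ab] := boolP (b != linv a); last first.
      rewrite (_ : [set w | _]%SET = finset.set0) ?cards0; last by apply/setP => w; rewrite !finset.inE.
      by rewrite !mulr_ge0 ?exprn_ge0 ?invr_ge0 //; lra.
    apply: turns_event (fun l => Hdev l a b ab) _ => //.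
    by move=> l T; apply: few_turns.
  - rewrite (_ : N3%:R * _ = #|{: 'I_p * letter k * 'I_n.+1}|%:R * (n.+1%:R * cB n)); last first.
      by rewrite card_prod card_ord natrM mulrA.
    apply: (@sum_bound _ (fun (x : 'I_p * letter k * 'I_n.+1) (w : sample k p n) => let: (j, c, z) := x in
      avoids hk (n %/ scale)./2 (fun i => w i) j c z)) => -[[j c] z].
    by rewrite /cB mE; apply: avoids_event.
  rewrite (_ : N4%:R * _ = #|{: 'I_p * 'I_p * {ffun letter k -> letter k} * bool *
     'I_n.+1 * 'I_n.+1 * 'I_n.+1}|%:R * (n.+1%:R * cB n)); last first.
    by rewrite 3!card_prod card_ord !natrM -!mulrA.
  apply: (@sum_bound _ (fun (x : 'I_p * 'I_p * {ffun letter k -> letter k} * bool *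
     'I_n.+1 * 'I_n.+1 * 'I_n.+1) (w : sample k p n) => let: (i, j, f, e, x, y, z) := x in
      copies hk (n %/ scale)./2 (fun i => w i) i j f e x y z)) => -[[[[[[i j] f] e] x] y] z].
  by rewrite /cB mE; apply: copies_event.
have [C1 [x [C10 /andP[x0 x1] Hx]]] := decay_bound.
(* The second term of the constant takes care of [n < scale]. *)
exists (C1 + x^-1 ^+ scale), x^-1; split.
- by rewrite addr_gt0 // exprn_gt0 // invr_gt0.
- by rewrite invf_gt1.
move=> n; rewrite -exprVn invrK.
have [le_n|lt_n] := leqP scale n.
  apply: le_trans (main n le_n) _; apply: le_trans (Hx n) _.
  by rewrite mulrDl lerDl mulr_ge0 ?exprn_ge0 ?invr_ge0 // ltW.
apply: le_trans (_ : 1 <= _).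
  rewrite /uniform_pr ler_pdivrMr ?mul1r ?ler_nat ?max_card //.
  rewrite ltr0n card_ffun expn_gt0; apply/orP; left; exact: (card_ball_gt0 R hk).
rewrite mulrDl; apply: le_trans (_ : x^-1 ^+ scale * x ^+ n <= _); last first.
  by rewrite lerDr mulr_ge0 ?exprn_ge0 // ltW.
rewrite exprVn mulrC ler_pdivlMr ?exprn_gt0 // mul1r.
by apply: ler_wiXn2l; [exact: ltW|exact: ltW|exact: ltnW].
Qed.
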